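(* Let $\mathbf{A}\in\mathbb{R}^{n\times d}$, $\mathbf{\Sigma}=\mathbf{A}^\top\mathbf{A}$ with largest eigenvalue $\lambda_1$, let $\epsilon\in(0,1)$, $\lambda=(1+\frac{\epsilon}{100})\lambda_1$ and $\mathbf{B}=\lambda\mathbf{I}-\mathbf{A}^\top\mathbf{A}$, and let $x_0\sim\mathcal{N}(0,\mathbf{I})$. Running the shifted-and-inverted power method on $\mathbf{B}$ initialized at $x_0$, using an accelerated SVRG-based linear system solver to approximately apply $\mathbf{B}^{-1}$ at each step, returns a unit vector $x$ such that with probability $1-O(1/d^{10})$, $x^\top\mathbf{\Sigma}x\ge(1-\epsilon)\lambda_1$, in total time $$O\left(\frac{\mathrm{nnz}(\mathbf{A})^{3/4}(d\,\mathrm{sr}(\mathbf{A}))^{1/4}}{\sqrt\epsilon}\cdot\log^3\left(\frac d\epsilon\right)\right).$$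
   Context: No eigengap assumption is made. $\mathrm{nnz}(\mathbf{A})$ is the number of nonzero entries of $\mathbf{A}$; $\mathrm{sr}(\mathbf{A})=\|\mathbf{A}\|_F^2/\|\mathbf{A}\|_2^2$ is the stable rank. Runtime counts arithmetic operations with $\mathbf{A}$ given explicitly.
   Formalization: A is assumed nonzero (else sr(A) and B^{-1} are undefined), and the time bound is claimed only when 1 < d ≤ nnz(A) ≤ d·sr(A)/ε²; otherwise one full gradient (cost nnz(A)) or drawing x_0 (cost d) can exceed it, or log(d/ε) can tend to 0. The accuracy claim needs no such restriction. *)

(* Defs.v *)
From HB Require Import structures.
From mathcomp Require Import all_boot all_order all_algebra.
From mathcomp Require Import all_classical all_reals all_analysis.

Set Implicit Arguments.
Unset Strict Implicit.
Unset Printing Implicit Defensive.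

Import Order.TTheory GRing.Theory Num.Theory.
Import numFieldNormedType.Exports.

Local Open Scope ring_scope.

(** * Matrix quantities *)

Section MatrixQuantities.
Variable R : realType.

(* Euclidean norm; the norm that mathcomp-analysis puts on matrices is the
   max norm. *)
Definition enorm d (x : 'cV[R]_d) : R := Num.sqrt (\sum_j x j 0 ^+ 2).

Definition nnz n d (A : 'M[R]_(n, d)) : nat :=
  #|[set ij : 'I_n * 'I_d | A ij.1 ij.2 != 0]|.

Definition frobenius2 n d (A : 'M[R]_(n, d)) : R := \sum_i \sum_j A i j ^+ 2.

Definition spectral_norm n d (A : 'M[R]_(n, d)) : R :=
  sup [set r | exists2 x : 'cV[R]_d, enorm x = 1 & r = enorm (A *m x)]%classic.

Definition stable_rank n d (A : 'M[R]_(n, d)) : R :=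
  frobenius2 A / spectral_norm A ^+ 2.

Definition largest_eigenvalue d (M : 'M[R]_d) (l : R) : Prop :=
  eigenvalue M l /\ forall m, eigenvalue M m -> m <= l.

Definition shifted n d (A : 'M[R]_(n, d)) (lam : R) : 'M[R]_d :=
  lam%:M - A^T *m A.

End MatrixQuantities.

(** * Randomized computations over the reals, with operation counting

   A computation is a tree whose internal nodes are the operations that are
   charged for: an arithmetic operation on reals, a test against 0, the draw
   of an index with probability proportional to given weights, and the draw of
   a standard normal. Each costs one unit. Storage access, loop control and
   returning a value are free. *)

Section Computations.
Variable R : realType.

Variant arith := RAdd of R & R | RSub of R & R | RMul of R & R | RDiv of R & R
  | RSqrt of R.

Definition arith_val (o : arith) : R :=
  match o with
  | RAdd x y => x + y
  | RSub x y => x - y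
  | RMul x y => x * y
  | RDiv x y => x / y
  | RSqrt x => Num.sqrt x
  end.

Inductive algo (X : Type) : Type :=
  | Ret of X
  | Op of arith & (R -> algo X)
  | IsZero of R & (bool -> algo X)
  | Draw n of ('I_n -> R) & ('I_n -> algo X)
  | Gauss of (R -> algo X).

Fixpoint bind X Y (c : algo X) (f : X -> algo Y) : algo Y :=
  match c with
  | Ret x => f x
  | Op o k => Op o (fun r => bind (k r) f)
  | IsZero r k => IsZero r (fun b => bind (k b) f)
  | Draw n w k => Draw w (fun i => bind (k i) f)
  | Gauss k => Gauss (fun r => bind (k r) f)
  end.

(* Probability that the result satisfies Q. Successive draws are independent,
   so the Gaussian draws contribute iterated integrals. *)
Fixpoint prob X (c : algo X) (Q : X -> Prop) : \bar R :=
  match c with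
  | Ret x => (`[< Q x >]%:R)%:E
  | Op o k => prob (k (arith_val o)) Q
  | IsZero r k => prob (k (r == 0)) Q
  | Draw n w k => (\sum_(i < n) (w i / \sum_(j < n) w j)%:E * prob (k i) Q)%E
  | Gauss k => (\int[normal_prob 0 1]_r prob (k r) Q)%E
  end.

(* Whatever the random draws, at most N operations are executed and the result
   satisfies Q. *)
Fixpoint runs X (c : algo X) (N : nat) (Q : X -> Prop) : Prop :=
  match c, N with
  | Ret x, _ => Q x
  | Op o k, N'.+1 => runs (k (arith_val o)) N' Q
  | IsZero r k, N'.+1 => runs (k (r == 0)) N' Q
  | Draw n w k, N'.+1 => forall i, runs (k i) N' Q
  | Gauss k, N'.+1 => forall r, runs (k r) N' Q
  | _, 0%N => False
  end.

Definition op (o : arith) : algo R := Op o (@Ret R).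

Fixpoint loop I S (s : seq I) (f : I -> S -> algo S) (x : S) : algo S :=
  if s is i :: s' then bind (f i x) (loop s' f) else Ret x.

Fixpoint repeat S (k : nat) (f : S -> algo S) (x : S) : algo S :=
  if k is k'.+1 then bind (f x) (repeat k' f) else Ret x.

End Computations.

Notation "x <- c ;; e" := (bind c (fun x => e))
  (at level 100, c at next level, right associativity).

(** * Vector operations *)

Section VectorOps.
Variable R : realType.

Definition setv d (v : 'cV[R]_d) (j : 'I_d) (r : R) : 'cV[R]_d :=
  \col_k (if k == j then r else v k 0).

Definition build d (f : 'I_d -> algo R R) : algo R 'cV[R]_d :=
  loop (enum 'I_d) (fun j v => r <- f j;; Ret R (setv v j r)) 0.

Definition vadd d (x y : 'cV[R]_d) := build (fun j => op (RAdd (x j 0) (y j 0))).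
Definition vsub d (x y : 'cV[R]_d) := build (fun j => op (RSub (x j 0) (y j 0))).
Definition vscale d (c : R) (x : 'cV[R]_d) := build (fun j => op (RMul c (x j 0))).

Definition sumsq d (x : 'cV[R]_d) : algo R R :=
  loop (enum 'I_d)
    (fun j s => q <- op (RMul (x j 0) (x j 0));; op (RAdd s q)) 0.

(* The first basis vector replaces x / |x| when x = 0. *)
Definition normalize d (x : 'cV[R]_d) : algo R 'cV[R]_d :=
  s <- sumsq x;;
  IsZero s (fun b =>
    if b then Ret R (\col_j (j == 0 :> nat)%:R)
    else r <- op (RSqrt s);; c <- op (RDiv 1 r);; vscale c x).

Definition gauss_vec d : algo R 'cV[R]_d := build (fun _ => Gauss (@Ret R R)).

(* A is stored by rows, each row as the list of its nonzero entries. *)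
Variables (n d : nat) (A : 'M[R]_(n, d)).

Definition row_support (i : 'I_n) : seq 'I_d :=
  [seq j <- enum 'I_d | A i j != 0].

(* a_i^T x, where a_i is the i-th row of A *)
Definition row_dot (i : 'I_n) (x : 'cV[R]_d) : algo R R :=
  loop (row_support i)
    (fun j s => q <- op (RMul (A i j) (x j 0));; op (RAdd s q)) 0.

(* x - c a_i *)
Definition row_subtract (i : 'I_n) (c : R) (x : 'cV[R]_d) : algo R 'cV[R]_d :=
  loop (row_support i)
    (fun j (v : 'cV[R]_d) => q <- op (RMul c (A i j));;
                r <- op (RSub (v j 0) q);; Ret R (setv v j r)) x.

(* The squared norms |a_i|^2 and their sum |A|_F^2. *)
Definition row_weights : algo R ('cV[R]_n * R) :=
  loop (enum 'I_n)
    (fun i => loop (row_support i)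
      (fun j (WF : 'cV[R]_n * R) =>
         q <- op (RMul (A i j) (A i j));;
         r <- op (RAdd (WF.1 i 0) q);;
         F <- op (RAdd WF.2 q);; Ret R (setv WF.1 i r, F))) (0, 0).

End VectorOps.

(** * The algorithm *)

Section Algorithm.
Variable R : realType.

Record params := Params {
  power_iters : nat;
  accel_iters : nat;
  epochs : nat;
  epoch_length : nat;
  step_size : R;
  regularizer : R;
  mixing : R;
  momentum : R;
  dual_step : R
}.

Variables (n d : nat) (A : 'M[R]_(n, d)).

(* The gradient sh w - A^T A w - h at w of 1/2 w^T (sh I - A^T A) w - h^T w. *)
Definition grad (sh : R) (h w : 'cV[R]_d) : algo R 'cV[R]_d :=
  sw <- vscale sh w;;
  g0 <- vsub sw h;;
  loop (enum 'I_n) (fun i g => c <- row_dot A i w;; row_subtract A i c g) g0.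

(* The objective of grad is split as the sum of the (nonconvex)
     psi_i(x) = 1/2 x^T (p_i sh I - a_i a_i^T) x - p_i h^T x,
   where p_i = W_i / F = |a_i|^2 / |A|_F^2. With anchor w, full gradient g at w,
   and i drawn with probability p_i, the step is
     x - eta ((grad psi_i(x) - grad psi_i(w)) / p_i + g)
       = x - eta (sh (x - w) - (F / W_i) a_i a_i^T (x - w) + g). *)
Definition svrg_step (W : 'cV[R]_n) (F sh eta : R) (w g x : 'cV[R]_d) :
    algo R 'cV[R]_d :=
  Draw (fun i => W i 0) (fun i =>
    u <- vsub x w;;
    c <- row_dot A i u;;
    ip <- op (RDiv F (W i 0));;
    q <- op (RMul ip c);;
    su <- vscale sh u;;
    v <- vadd su g;;
    v' <- row_subtract A i q v;;
    ev <- vscale eta v';;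
    vsub x ev).

(* One epoch of m steps started at w; returns the average of the iterates
   x_0, ..., x_(m-1). *)
Definition svrg_epoch (W : 'cV[R]_n) (F sh eta : R) (m : nat)
    (h w : 'cV[R]_d) : algo R 'cV[R]_d :=
  g <- grad sh h w;;
  xs <- repeat m (fun xs : 'cV[R]_d * 'cV[R]_d =>
    s <- vadd xs.2 xs.1;;
    x <- svrg_step W F sh eta w g xs.1;;
    Ret R (x, s)) (w, 0);;
  c <- op (RDiv 1 m%:R);;
  vscale c xs.2.

(* Approximate minimization, by SVRG started at y, of
     1/2 x^T B x - b^T x + gam/2 |x - y|^2,   B = shifted A lam. *)
Definition svrg_prox (P : params) (W : 'cV[R]_n) (F lam : R)
    (b y : 'cV[R]_d) : algo R 'cV[R]_d :=
  sh <- op (RAdd lam (regularizer P));;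
  gy <- vscale (regularizer P) y;;
  h <- vadd b gy;;
  repeat (epochs P)
    (svrg_epoch W F sh (step_size P) (epoch_length P) h) y.

(* Accelerated approximate proximal point method for B x = b, started at 0:
     y  = (1 - a) x + a v,
     x' = approximate proximal step at y,
     v' = (1 - m) v + m (y - s (y - x')),
   with a = mixing, m = momentum, s = dual_step. *)
Definition accel_step (P : params) (W : 'cV[R]_n) (F lam : R) (b : 'cV[R]_d)
    (xv : 'cV[R]_d * 'cV[R]_d) : algo R ('cV[R]_d * 'cV[R]_d) :=
  a' <- op (RSub 1 (mixing P));;
  y1 <- vscale a' xv.1;;
  y2 <- vscale (mixing P) xv.2;;
  y <- vadd y1 y2;;
  x <- svrg_prox P W F lam b y;;
  yx <- vsub y x;;
  syx <- vscale (dual_step P) yx;;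
  z <- vsub y syx;;
  m' <- op (RSub 1 (momentum P));;
  v1 <- vscale m' xv.2;;
  v2 <- vscale (momentum P) z;;
  v <- vadd v1 v2;;
  Ret R (x, v).

Definition accel_svrg (P : params) (W : 'cV[R]_n) (F lam : R) (b : 'cV[R]_d) :
    algo R 'cV[R]_d :=
  xv <- repeat (accel_iters P) (accel_step P W F lam b) (0, 0);;
  Ret R xv.1.

(* Power method on the inverse of B = shifted A lam, from x_0 ~ N(0, I), each
   application of the inverse being approximated by accel_svrg. *)
Definition shift_invert_power (lam : R) (P : params) : algo R 'cV[R]_d :=
  WF <- row_weights A;;
  x0 <- gauss_vec R d;;
  repeat (power_iters P)
    (fun x => y <- accel_svrg P WF.1 WF.2 lam x;; normalize y) x0.

End Algorithm.

(** * Correctness and cost of the deterministic building blocks *)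

Section Specifications.
Variable R : realType.

Lemma runs_weaken X (c : algo R X) N N' Q Q' :
  (N <= N')%N -> (forall x, Q x -> Q' x) -> runs c N Q -> runs c N' Q'.
Proof.
move=> NN' QQ'; elim: c N N' NN' => [x|o k IH|r k IH|n w k IH|k IH] [|N] [|N'] //= NN';
  try by [move=> /QQ' | apply: IH | move=> H i; apply: IH (H i)].
Qed.

Lemma runs_bind X Y (c : algo R X) (f : X -> algo R Y) N M Q Q' :
  runs c N Q -> (forall x, Q x -> runs (f x) M Q') -> runs (bind c f) (N + M) Q'.
Proof.
move=> + H; elim: c N => [x|o k IH|r k IH|n w k IH|k IH] [|N] //=;
  try by [move=> /H; apply: runs_weaken; rewrite ?leq_addl
         | apply: IH | move=> Hk i; apply: IH].
Qed.

Lemma runs_loop I S (P : seq I -> S -> Prop) (cost : I -> nat)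
    (f : I -> S -> algo R S) s x :
  (forall i s x, P (i :: s) x -> runs (f i x) (cost i) (P s)) ->
  P s x -> runs (loop s f x) (\sum_(i <- s) cost i)%N (P [::]).
Proof.
move=> Hf; elim: s x => [|i s IH] x Px; first by case: (\sum_(i <- _) _)%N.
rewrite big_cons; exact: runs_bind (Hf _ _ _ Px) IH.
Qed.

Lemma runs_build d (f : 'I_d -> algo R R) (g : 'I_d -> R) c :
  (forall j, runs (f j) c (fun r => r = g j)) ->
  runs (build f) (d * c) (fun v => v = \col_j g j).
Proof.
move=> Hf.
have := @runs_loop _ _ (fun s (v : 'cV[R]_d) => forall k, k \notin s -> v k 0 = g k)
  (fun=> c) (fun j v => r <- f j;; Ret R (setv v j r)) (enum 'I_d) 0.
have -> : (\sum_(i <- enum 'I_d) c)%N = (d * c)%N.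
  by rewrite big_enum sum_nat_const cardE size_enum_ord.
move=> H; apply: (runs_weaken (leqnn _) _ (H _ _)); clear H.
- by move=> v Hv; apply/colP => j; rewrite mxE Hv.
- move=> j s v Hv; rewrite -[c]addn0.
  apply: runs_bind (Hf j) _ => _ -> /= k ks; rewrite mxE.
  by case: eqVneq => [->//|kj]; apply: Hv; rewrite inE negb_or kj.
- by move=> k; rewrite mem_enum.
Qed.

Lemma runs_vadd d (x y : 'cV[R]_d) : runs (vadd x y) d (eq^~ (x + y)).
Proof.
rewrite -[d in runs _ d]muln1.
apply: (runs_weaken (leqnn _) _ (runs_build (g := fun j => x j 0 + y j 0) _)) => //.
by move=> _ ->; apply/colP => j; rewrite !mxE.
Qed.

Lemma runs_vsub d (x y : 'cV[R]_d) : runs (vsub x y) d (eq^~ (x - y)).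
Proof.
rewrite -[d in runs _ d]muln1.
apply: (runs_weaken (leqnn _) _ (runs_build (g := fun j => x j 0 - y j 0) _)) => //.
by move=> _ ->; apply/colP => j; rewrite !mxE.
Qed.

Lemma runs_vscale d c (x : 'cV[R]_d) : runs (vscale c x) d (eq^~ (c *: x)).
Proof.
rewrite -[d in runs _ d]muln1.
apply: (runs_weaken (leqnn _) _ (runs_build (g := fun j => c * x j 0) _)) => //.
by move=> _ ->; apply/colP => j; rewrite !mxE.
Qed.

Variables (n d : nat) (A : 'M[R]_(n, d)).

Lemma nnzE : nnz A = (\sum_(i < n) size (row_support A i))%N.
Proof.
rewrite /nnz -sum1_card.
rewrite (eq_bigl (fun ij : 'I_n * 'I_d => true && (A ij.1 ij.2 != 0))); last first.
  by move=> ij; rewrite inE.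
rewrite -(pair_big_dep xpredT (fun i j => A i j != 0) (fun _ _ => 1%N)) /=.
apply: eq_bigr => i _.
by rewrite /row_support size_filter -sum1_count big_enum_cond.
Qed.

Lemma runs_row_dot i (x : 'cV[R]_d) :
  runs (row_dot A i x) (2 * size (row_support A i)) (eq^~ ((A *m x) i 0)).
Proof.
have := @runs_loop _ _ (fun s r => r + \sum_(j <- s) A i j * x j 0 = (A *m x) i 0)
  (fun=> 2%N) (fun j s => q <- op (RMul (A i j) (x j 0));; op (RAdd s q))
  (row_support A i) 0.
rewrite big_const_seq count_predT iter_addn_0.
move=> H; apply: (runs_weaken (leqnn _) _ (H _ _)); clear H.
- by move=> r; rewrite big_nil addr0.
- by move=> j s r /=; rewrite big_cons addrA.
- rewrite add0r /row_support big_filter big_enum_cond mxE /= [RHS](bigID (fun j => A i j != 0)) /=.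
  rewrite [X in _ + X]big1 ?addr0 // => j; rewrite negbK => /eqP ->; exact: mul0r.
Qed.

Lemma runs_row_subtract i c (x : 'cV[R]_d) :
  runs (row_subtract A i c x) (2 * size (row_support A i))
    (eq^~ (x - c *: (row i A)^T)).
Proof.
have := @runs_loop _ _ (fun s (v : 'cV[R]_d) => uniq s /\ forall k, v k 0 = x k 0 -
    (if k \in s then 0 else c * A i k))
  (fun=> 2%N) (fun j (v : 'cV[R]_d) => q <- op (RMul c (A i j));;
     r <- op (RSub (v j 0) q);; Ret R (setv v j r))
  (row_support A i) x.
rewrite big_const_seq count_predT iter_addn_0.
move=> H; apply: (runs_weaken (leqnn _) _ (H _ _)); clear H.
- by move=> v [_ Hv]; apply/colP => k; rewrite Hv !mxE.
- move=> j s v [] /= /andP[js us] Hv; split=> // k; rewrite mxE.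
  have [->|kj] := eqVneq k j; first by rewrite Hv inE eqxx (negbTE js) subr0.
  by rewrite Hv inE (negbTE kj).
- split; first by rewrite filter_uniq ?enum_uniq.
  move=> k; rewrite mem_filter mem_enum andbT.
  by case: eqVneq => [->|_] /=; rewrite ?mulr0 subr0.
Qed.

Lemma runs_grad lam h (w : 'cV[R]_d) :
  runs (grad A lam h w) (2 * d + 4 * nnz A) (eq^~ (shifted A lam *m w - h)).
Proof.
rewrite mul2n -addnn -addnA.
apply: runs_bind (runs_vscale _ _) _ => _ ->.
apply: runs_bind (runs_vsub _ _) _ => _ ->.
have := @runs_loop _ _ (fun s (g : 'cV[R]_d) =>
    g - \sum_(i <- s) (A *m w) i 0 *: (row i A)^T = shifted A lam *m w - h)
  (fun i => 4 * size (row_support A i))%N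
  (fun i g => c <- row_dot A i w;; row_subtract A i c g) (enum 'I_n) (lam *: w - h).
have -> : (\sum_(i <- enum 'I_n) 4 * size (row_support A i) = 4 * nnz A)%N.
  by rewrite nnzE big_distrr /= big_enum.
move=> H; apply: (runs_weaken (leqnn _) _ (H _ _)); clear H.
- by move=> g; rewrite big_nil subr0.
- move=> i s g; rewrite big_cons => Hg.
  rewrite [X in runs _ X _](_ : _ = 2 * size (row_support A i) +
    2 * size (row_support A i))%N; last by rewrite -mulnDl.
  apply: runs_bind (runs_row_dot _ _) _ => _ ->.
  apply: runs_weaken (leqnn _) _ (runs_row_subtract _ _ _) => _ ->.
  by rewrite -Hg opprD addrA.
- rewrite mulmxBl mul_scalar_mx -mulmxA addrAC; congr (_ - _ - _).
  apply/colP => j; rewrite big_enum summxE mxE; apply: eq_bigr => i _.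
  by rewrite !mxE mulrC.
Qed.

End Specifications.

(* Main.v *)
Require Import Defs.
From HB Require Import structures.
From mathcomp Require Import all_boot all_order all_algebra.
From mathcomp Require Import all_classical all_reals all_analysis.
From mathcomp Require Import measurable_realfun.
From mathcomp Require Import ring lra zify.

Import Order.TTheory GRing.Theory Num.Theory.
Import numFieldNormedType.Exports.

Set Implicit Arguments.
Unset Strict Implicit.
Unset Printing Implicit Defensive.

Local Open Scope ring_scope.

(** Write [B = lambda I - A^T A], whose least eigenvalue is
   [mu = eps lambda1 / 100], and [D = mu B^-1], which fixes the top
   eigenvector [u]. The moments [<x0, D^k x0>] are log-convex and at least
   [<u, x0>^2]; hence after [T = O(log (d / eps))] exact iterations one of the
   ratios, and so the last, is at least [1 / 51], which bounds the Rayleigh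
   quotient of [B] at [D^T x0] by [51 mu] without any gap or spectral
   decomposition. Errors of relative size [(eps / d)^O(1)] in the applications
   of [D] only add up, because [D] is a contraction, and Markov's inequality
   turns the expected squared error of the solver into a failure probability.

   A proximal step of parameter [gam = lambda1 beta],
   [beta = sqrt (d sr(A) / nnz(A))], is a linear system in [M = B + gam I].
   One SVRG epoch of length [O(sr(A) / beta^2) = O(nnz(A) / d)] divides the
   expected [M]-energy of the error by 4, the variance of the sampled
   gradient at [x] being at most [|A|_F^2 lambda1 |x - w|^2] when [w] is the
   anchor. The potential [<x, B x> + mu |v|^2] of the errors of the accelerated
   iterates contracts by [1 - sqrt (mu / (mu + gam))] under exact proximal
   steps, and being a squared norm it absorbs the inner error with
   half of that rate. Each of the three loops contributes one logarithm, and
   [nnz(A) sqrt (gam / mu)] is the stated main term.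

   For the start, the means of [exp (1/2 - <u, x>^2 / (2 delta^2))] and of
   [exp (|x|^2 / 4 - d)] under the Gaussian law are computed one coordinate at
   a time; they bound the probabilities of a small correlation with [u] and
   of a large norm. *)

(** * Gauss-free computations *)

Section Expectation.
Variable R : realType.

(* The value at a Gauss node is junk; it is excluded by [discrete]. *)
Fixpoint expect X (c : algo R X) (g : X -> R) : R :=
  match c with
  | Ret x => g x
  | Op o k => expect (k (arith_val o)) g
  | IsZero r k => expect (k (r == 0)) g
  | Draw n w k => \sum_(i < n) w i / (\sum_(j < n) w j) * expect (k i) g
  | Gauss k => 0
  end.

Fixpoint discrete X (c : algo R X) : Prop :=
  match c with
  | Ret x => True
  | Op o k => discrete (k (arith_val o))
  | IsZero r k => discrete (k (r == 0))
  | Draw n w k => [/\ forall i, 0 <= w i, 0 < \sum_(j < n) w j &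
                     forall i, discrete (k i)]
  | Gauss k => False
  end.

Fixpoint drawless X (c : algo R X) : Prop :=
  match c with
  | Ret x => True
  | Op o k => drawless (k (arith_val o))
  | IsZero r k => drawless (k (r == 0))
  | _ => False
  end.

(** Binding such a computation amounts to substituting its value, which carries the specifications
    stated with [runs] over to [expect] and [prob]. *)
Fixpoint computes X (c : algo R X) (v : X) : Prop :=
  match c with
  | Ret x => x = v
  | Op o k => computes (k (arith_val o)) v
  | IsZero r k => computes (k (r == 0)) v
  | _ => False
  end.

Lemma drawless_bind X Y (c : algo R X) (f : X -> algo R Y) :
  drawless c -> (forall x, drawless (f x)) -> drawless (bind c f).
Proof. by elim: c => //= [oo k IH|r k IH] H Hf; exact: IH. Qed.

Lemma drawless_loop I S (s : seq I) (f : I -> S -> algo R S) x :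
  (forall i x, drawless (f i x)) -> drawless (loop s f x).
Proof.
move=> Hf; elim: s x => [|i s IH] x //=; exact: drawless_bind.
Qed.

Lemma drawless_build d (f : 'I_d -> algo R R) :
  (forall j, drawless (f j)) -> drawless (build f).
Proof. by move=> Hf; apply: drawless_loop => i x; apply: drawless_bind. Qed.

(** [drawless] is asked separately because [runs] also accepts a computation that draws and returns
    the same value on every outcome. *)
Lemma runs_computes X (c : algo R X) N v :
  drawless c -> runs c N (eq^~ v) -> computes c v.
Proof.
elim: c N => [x|oo k IH|r k IH|n w k IH|k IH] N //=.
- by case: N => // N; exact: IH.
- by case: N => // N; exact: IH.
Qed.

Lemma runs_computesW X (c : algo R X) N v (Q : X -> Prop) :
  runs c N Q -> computes c v -> Q v.
Proof.
elim: c N => [x|oo k IH|r k IH|n w k IH|k IH] N //=.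
- by case: N => [|N] Qx <-.
- by case: N => // N; exact: IH.
- by case: N => // N; exact: IH.
Qed.

Lemma drawless_computes X (c : algo R X) : drawless c -> exists v, computes c v.
Proof. by elim: c => //= [x _|oo k IH|r k IH]; [exists x|exact: IH|exact: IH]. Qed.

Lemma expect_bind X Y (c : algo R X) (f : X -> algo R Y) g :
  expect (bind c f) g = expect c (fun x => expect (f x) g).
Proof.
by elim: c => //= n w k IH; apply: eq_bigr => i _; rewrite IH.
Qed.

Lemma expect_computes X Y (c : algo R X) (f : X -> algo R Y) v g :
  computes c v -> expect (bind c f) g = expect (f v) g.
Proof. by elim: c => //= [x ->|oo k IH|r k IH] //; exact: IH. Qed.

Lemma prob_computes X Y (c : algo R X) (f : X -> algo R Y) v Q :
  computes c v -> prob (bind c f) Q = prob (f v) Q.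
Proof. by elim: c => //= [x ->|oo k IH|r k IH] //; exact: IH. Qed.

Lemma discrete_computes X Y (c : algo R X) (f : X -> algo R Y) v :
  computes c v -> discrete (f v) -> discrete (bind c f).
Proof. by elim: c => //= [x ->|oo k IH|r k IH] //; exact: IH. Qed.

Lemma discrete_bind X Y (c : algo R X) (f : X -> algo R Y) :
  discrete c -> (forall x, discrete (f x)) -> discrete (bind c f).
Proof.
elim: c => //= [oo k IH|r k IH|n w k IH] H Hf; [exact: IH|exact: IH|].
by case: H => w0 sw Hk; split=> // i; exact: IH.
Qed.

(** Turns a tail call into a [bind], the form in which [expect_computes] rewrites. *)
Lemma bind_ret X (c : algo R X) : bind c (@Ret R X) = c.
Proof.
by elim: c => //= [oo k IH|r k IH|n w k IH|k IH]; congr (_ _);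
  apply/funext => i; rewrite IH.
Qed.

Lemma repeatS S k (f : S -> algo R S) x :
  repeat k.+1 f x = bind (f x) (repeat k f).
Proof. by []. Qed.

Lemma discrete_repeat S k (f : S -> algo R S) x :
  (forall x, discrete (f x)) -> discrete (repeat k f x).
Proof. by move=> Hf; elim: k x => [|k IH] x //=; exact: discrete_bind. Qed.

Lemma le_expect X (c : algo R X) g h :
  discrete c -> (forall x, g x <= h x) -> expect c g <= expect c h.
Proof.
elim: c => //= [oo k IH|r k IH|n w k IH] H Hf; [exact: IH|exact: IH|].
case: H => w0 sw Hk; apply: ler_sum => i _; apply: ler_wpM2l; last exact: IH.
by apply: divr_ge0 => //; exact: ltW.
Qed.

Lemma expectD X (c : algo R X) g h :
  expect c (fun x => g x + h x) = expect c g + expect c h.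
Proof.
elim: c => //= [n w k IH|k IH]; last by rewrite addr0.
by rewrite -big_split /=; apply: eq_bigr => i _; rewrite IH mulrDr.
Qed.

Lemma expectZ X (c : algo R X) a g :
  expect c (fun x => a * g x) = a * expect c g.
Proof.
elim: c => //= [n w k IH|k IH]; last by rewrite mulr0.
by rewrite big_distrr /=; apply: eq_bigr => i _; rewrite IH mulrCA.
Qed.

Lemma expect_cst X (c : algo R X) a : discrete c -> expect c (fun=> a) = a.
Proof.
elim: c => //= [oo k IH|r k IH|n w k IH] H; [exact: IH|exact: IH|].
case: H => w0 sw Hk; transitivity (\sum_(i < n) w i / (\sum_j w j) * a).
  by apply: eq_bigr => i _; rewrite IH.
by rewrite -big_distrl -big_distrl /= divff ?mul1r // gt_eqF.
Qed.

Lemma expect_ge0 X (c : algo R X) g :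
  discrete c -> (forall x, 0 <= g x) -> 0 <= expect c g.
Proof. by move=> dc g0; rewrite -(expect_cst 0 dc); exact: le_expect. Qed.

Lemma probE X (c : algo R X) (Q : X -> Prop) :
  discrete c -> prob c Q = (expect c (fun x => `[< Q x >]%:R))%:E.
Proof.
elim: c => //= [oo k IH|r k IH|n w k IH] H; [exact: IH|exact: IH|].
case: H => w0 sw Hk; rewrite -sumEFin; apply: eq_bigr => i _.
by rewrite IH // EFinM.
Qed.

Lemma prob_ge0 X (c : algo R X) (Q : X -> Prop) :
  discrete c -> (0 <= prob c Q)%E.
Proof. by move=> dc; rewrite probE // lee_fin expect_ge0. Qed.

(** Markov's inequality joined to a union bound: [g] dominates the indicator of [~ P], so
    [expect c g] pays for a failed first stage. *)
Lemma prob_bind_ge X Y (c : algo R X) (f : X -> algo R Y)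
    (P : X -> Prop) (Q : Y -> Prop) (g : X -> R) (a : R) :
  discrete c -> (forall x, discrete (f x)) -> 0 <= a -> a <= 1 ->
  (forall x, 0 <= g x) -> (forall x, ~ P x -> 1 <= g x) ->
  (forall x, P x -> (a%:E <= prob (f x) Q)%E) ->
  ((a - expect c g)%:E <= prob (bind c f) Q)%E.
Proof.
move=> dc df a0 a1 g0 gP PQ.
rewrite probE; last exact: discrete_bind.
rewrite lee_fin expect_bind lerBlDr -(expect_cst a dc) -expectD.
apply: le_expect => // x.
have [Px|nPx] := pselect (P x).
  rewrite -[leLHS]addr0 lerD //.
  by have := PQ _ Px; rewrite probE // lee_fin.
rewrite -[leLHS]add0r lerD //; last by rewrite (le_trans a1) ?gP.
exact: expect_ge0.
Qed.

Lemma expect_repeat S k (f : S -> algo R S) (g : S -> R) q x :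
  0 <= q -> (forall x, discrete (f x)) ->
  (forall x, expect (f x) g <= q * g x) ->
  expect (repeat k f x) g <= q ^+ k * g x.
Proof.
move=> q0 df fq; elim: k x => [|k IH] x /=; first by rewrite mul1r.
rewrite expect_bind exprSr -mulrA.
apply: le_trans (le_expect (df x) IH) _.
by rewrite expectZ ler_wpM2l // exprn_ge0.
Qed.

End Expectation.

(** * Quadratic forms *)

Section Forms.
Variable R : realType.

Definition dot d (x y : 'cV[R]_d) : R := \sum_j x j 0 * y j 0.

Definition form d (M : 'M[R]_d) (x y : 'cV[R]_d) : R := dot x (M *m y).

Definition psd d (M : 'M[R]_d) := M^T = M /\ forall x, 0 <= form M x x.

Section Dot.
Variable d : nat.
Implicit Types (x y z : 'cV[R]_d) (a : R) (M : 'M[R]_d).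

Lemma dotC x y : dot x y = dot y x.
Proof. by apply: eq_bigr => j _; rewrite mulrC. Qed.

Lemma dotDl x y z : dot (x + y) z = dot x z + dot y z.
Proof. by rewrite -big_split /=; apply: eq_bigr => j _; rewrite mxE mulrDl. Qed.

Lemma dotZl a x y : dot (a *: x) y = a * dot x y.
Proof. by rewrite big_distrr /=; apply: eq_bigr => j _; rewrite mxE mulrA. Qed.

Lemma dotDr x y z : dot x (y + z) = dot x y + dot x z.
Proof. by rewrite dotC dotDl !(dotC x). Qed.

Lemma dotZr a x y : dot x (a *: y) = a * dot x y.
Proof. by rewrite dotC dotZl dotC. Qed.

Lemma dotNl x y : dot (- x) y = - dot x y.
Proof. by rewrite -scaleN1r dotZl mulN1r. Qed.

Lemma dotNr x y : dot x (- y) = - dot x y.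
Proof. by rewrite dotC dotNl dotC. Qed.

Lemma dot0l x : dot 0 x = 0.
Proof. by rewrite -(scale0r 0) dotZl mul0r. Qed.

Lemma dot0r x : dot x 0 = 0.
Proof. by rewrite dotC dot0l. Qed.

Lemma dotxx_ge0 x : 0 <= dot x x.
Proof. by apply: sumr_ge0 => j _; rewrite -expr2 sqr_ge0. Qed.

Lemma dotxx_eq0 x : (dot x x == 0) = (x == 0).
Proof.
apply/eqP/eqP => [|->]; last by rewrite dot0l.
move/eqP; rewrite psumr_eq0 => [|j _]; last by rewrite -expr2 sqr_ge0.
move/allP => H; apply/colP => j; rewrite mxE.
by have := H j (mem_index_enum j); rewrite -expr2 sqrf_eq0 => /eqP.
Qed.

Lemma dotxx_gt0 x : (0 < dot x x) = (x != 0).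
Proof. by rewrite lt_neqAle dotxx_ge0 andbT eq_sym dotxx_eq0. Qed.

End Dot.

Section Form.
Variable d : nat.
Implicit Types (x y z : 'cV[R]_d) (a : R) (M : 'M[R]_d).

Lemma dot_mulmxl n (A : 'M[R]_(n, d)) (y : 'cV[R]_n) x :
  dot (A^T *m y) x = dot y (A *m x).
Proof.
rewrite /dot; under eq_bigr do rewrite mxE big_distrl /=.
rewrite exchange_big /=; apply: eq_bigr => i _; rewrite mxE big_distrr /=.
by apply: eq_bigr => j _; rewrite mxE mulrCA mulrA.
Qed.

Lemma dotE x y : dot x y = (x^T *m y) 0 0.
Proof. by rewrite mxE; apply: eq_bigr => j _; rewrite mxE. Qed.

Lemma enormE x : enorm x = Num.sqrt (dot x x).
Proof. by rewrite /enorm; congr Num.sqrt; apply: eq_bigr => j _. Qed.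

Lemma formDl M x y z : form M (x + y) z = form M x z + form M y z.
Proof. exact: dotDl. Qed.
Lemma formDr M x y z : form M x (y + z) = form M x y + form M x z.
Proof. by rewrite /form mulmxDr dotDr. Qed.
Lemma formZl M a x y : form M (a *: x) y = a * form M x y.
Proof. exact: dotZl. Qed.
Lemma formZr M a x y : form M x (a *: y) = a * form M x y.
Proof. by rewrite /form -scalemxAr dotZr. Qed.
Lemma formNl M x y : form M (- x) y = - form M x y.
Proof. exact: dotNl. Qed.
Lemma formNr M x y : form M x (- y) = - form M x y.
Proof. by rewrite /form mulmxN dotNr. Qed.
Lemma form0l M x : form M 0 x = 0.
Proof. exact: dot0l. Qed.

Definition formE := (formDl, formDr, formNl, formNr, formZl, formZr).
Definition dotL := (dotDl, dotDr, dotNl, dotNr, dotZl, dotZr).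

Lemma formB M N x y : form (M - N) x y = form M x y - form N x y.
Proof. by rewrite /form mulmxBl dotDr dotNr. Qed.

Lemma form_scalar a x y : form a%:M x y = a * dot x y.
Proof. by rewrite /form mul_scalar_mx dotZr. Qed.

Lemma form_sym M x y : M^T = M -> form M x y = form M y x.
Proof. by move=> sM; rewrite /form -dot_mulmxl sM dotC. Qed.

Lemma form_gram n (A : 'M[R]_(n, d)) x y :
  form (A^T *m A) x y = dot (A *m x) (A *m y).
Proof. by rewrite /form -mulmxA dotC dot_mulmxl dotC. Qed.

Lemma gram_sym n (A : 'M[R]_(n, d)) : (A^T *m A)^T = A^T *m A.
Proof. by rewrite trmx_mul trmxK. Qed.

Lemma psd_CS M x y : psd M -> form M x y ^+ 2 <= form M x x * form M y y.
Proof.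
case=> sM pM.
have H s t : 0 <= s ^+ 2 * form M x x + 2 * s * t * form M x y
                 + t ^+ 2 * form M y y.
  have := pM (s *: x + t *: y); rewrite !formE (form_sym y x sM).
  by move=> Hst; lra.
have [c0|c0] := eqVneq (form M y y) 0.
  (* With these coefficients the quadratic expression equals [- form M x y ^+ 2]. *)
  have := H (form M x y) (- (form M x x + 1) / 2); rewrite c0 => Hs.
  by rewrite mulr0; nra.
have c1 : 0 < form M y y by rewrite lt_neqAle eq_sym c0 pM.
have Hs := H (form M y y) (- form M x y).
rewrite -subr_ge0 -(pmulr_rge0 _ c1); by lra.
Qed.

Lemma dot_CS x y : dot x y ^+ 2 <= dot x x * dot y y.
Proof.
have := @psd_CS 1%:M x y; rewrite /form !mul1mx; apply; split.
  by rewrite trmx1.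
by move=> z; rewrite /form mul1mx dotxx_ge0.
Qed.

(* [s] stands for [1 / t]. *)
Lemma form_AMGM M x y t s : psd M -> 0 < t -> t * s = 1 ->
  2 * form M x y <= t * form M x x + s * form M y y.
Proof.
move=> [sM pM] t0 ts; have := pM (t *: x - y).
rewrite !formE (form_sym y x sM) => H.
have s0 : 0 < s by rewrite -(pmulr_rgt0 _ t0) ts.
rewrite -subr_ge0.
have -> : t * form M x x + s * form M y y - 2 * form M x y =
  s * (t * (t * form M x x + - form M x y) + - (t * form M x y + - form M y y)).
  transitivity (t * (t * s) * form M x x + s * form M y y
                - 2 * (t * s) * form M x y); first by rewrite ts; ring.
  by ring.
by rewrite pmulr_rge0 //; lra.
Qed.

Lemma form_sqrD M x y t s : psd M -> 0 < t -> t * s = 1 ->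
  form M (x + y) (x + y) <= (1 + t) * form M x x + (1 + s) * form M y y.
Proof.
move=> pM t0 ts; have := form_AMGM x y pM t0 ts.
by rewrite !formE (form_sym y x pM.1); nra.
Qed.

Lemma psd_scalar a : 0 <= a -> psd (a%:M : 'M[R]_d).
Proof.
move=> a0; split; first by rewrite tr_scalar_mx.
by move=> x; rewrite form_scalar mulr_ge0 // dotxx_ge0.
Qed.

Lemma dot_sqrD x y t s : 0 < t -> t * s = 1 ->
  dot (x + y) (x + y) <= (1 + t) * dot x x + (1 + s) * dot y y.
Proof.
move=> t0 ts; have := @form_sqrD 1%:M x y t s (psd_scalar ler01) t0 ts.
by rewrite !form_scalar !mul1r.
Qed.

(** A row of the left kernel of [M] has zero quadratic form, hence vanishes. *)
Lemma posdef_unit M k : M^T = M -> 0 < k ->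
  (forall x, k * dot x x <= form M x x) -> M \in unitmx.
Proof.
move=> sM k0 Mk; rewrite -row_free_unit -kermx_eq0.
apply/eqP/row_matrixP => i; rewrite row0.
set v := row i _.
have vM : v *m M = 0 by apply/eqP; rewrite -sub_kermx row_sub.
have := Mk v^T; rewrite /form -{1}sM -trmx_mul vM trmx0 dot0r => H.
have : dot v^T v^T == 0.
  by rewrite eq_le dotxx_ge0 andbT -(pmulr_rle0 _ k0).
by rewrite dotxx_eq0 => /eqP /(congr1 trmx); rewrite trmxK trmx0.
Qed.

(** Cauchy-Schwarz for the form of [M] between [x] and [M x] gives
    [|M x|^4 <= <x, M x> <M x, M (M x)>], and the last factor is at most [s |M x|^2]. *)
Lemma psd_sqr_le M s x : psd M -> (forall z, form M z z <= s * dot z z) ->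
  dot (M *m x) (M *m x) <= s * form M x x.
Proof.
move=> pM Ms; have := psd_CS x (M *m x) pM.
have -> : form M x (M *m x) = dot (M *m x) (M *m x).
  by rewrite /form -dot_mulmxl pM.1.
set q := dot _ _ => H.
have := ler_wpM2l (pM.2 x) (Ms (M *m x)); rewrite -/q => H2.
have [q0|q0] := eqVneq q 0.
  have [x0|] := eqVneq (dot x x) 0; last first.
    move=> nx; rewrite q0; apply: mulr_ge0; last exact: pM.2.
    have := le_trans (pM.2 x) (Ms x).
    by rewrite pmulr_lge0 // lt_neqAle eq_sym nx dotxx_ge0.
  move/eqP: x0; rewrite dotxx_eq0 => /eqP ->.
  by rewrite q0 form0l mulr0.
have qp : 0 < q by rewrite lt_neqAle eq_sym q0 dotxx_ge0.
by rewrite -(ler_pM2r qp) -expr2 (le_trans H) // (le_trans H2) // mulrA [form _ _ _ * _]mulrC.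
Qed.

Lemma dot_row n (A : 'M[R]_(n, d)) i x : dot (row i A)^T x = (A *m x) i 0.
Proof. by rewrite mxE; apply: eq_bigr => j _; rewrite !mxE. Qed.

Lemma dot_rowrow n (A : 'M[R]_(n, d)) i :
  dot (row i A)^T (row i A)^T = \sum_j A i j ^+ 2.
Proof. by apply: eq_bigr => j _; rewrite !mxE. Qed.

Lemma frobenius2_bound n (A : 'M[R]_(n, d)) x :
  dot (A *m x) (A *m x) <= frobenius2 A * dot x x.
Proof.
rewrite /frobenius2 big_distrl /=; apply: ler_sum => i _.
by rewrite -expr2 -dot_row -dot_rowrow dot_CS.
Qed.

Lemma mulmx_bounded n (A : 'M[R]_(n, d)) :
  exists2 c, 0 < c & forall x, dot (A *m x) (A *m x) <= c * dot x x.
Proof.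
exists (1 + frobenius2 A).
  rewrite ltr_pwDl //; apply: sumr_ge0 => i _; apply: sumr_ge0 => j _.
  exact: sqr_ge0.
move=> x; rewrite mulrDl mul1r (le_trans (frobenius2_bound A x)) //.
by rewrite lerDr dotxx_ge0.
Qed.

(* The supremum of the Rayleigh quotient is an eigenvalue: otherwise
   [rho I - S] would be invertible and positive, hence bounded below, and
   [rho] could be decreased. *)
Lemma rayleigh_le (S : 'M[R]_d) l : S^T = S ->
  (forall m, eigenvalue S m -> m <= l) ->
  forall x, form S x x <= l * dot x x.
Proof.
move=> sS Hl x.
have [->|x0] := eqVneq x 0; first by rewrite form0l dot0l mulr0.
pose E : set R := [set r | exists2 z, dot z z = 1 & r = form S z z]%classic.
have unit_scale z : z != 0 -> E ((dot z z)^-1 * form S z z).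
  move=> z0; have zz : 0 < dot z z by rewrite dotxx_gt0.
  have sz : (Num.sqrt (dot z z))^-1 ^+ 2 = (dot z z)^-1.
    by rewrite exprVn sqr_sqrtr // dotxx_ge0.
  exists ((Num.sqrt (dot z z))^-1 *: z).
    by rewrite dotZl dotZr mulrA -expr2 sz mulVf // gt_eqF.
  by rewrite formZl formZr [RHS]mulrA -expr2 sz.
have E0 : (E !=set0)%classic by exists ((dot x x)^-1 * form S x x); exact: unit_scale.
have [c c0 Hc] := mulmx_bounded S.
(* Expanding [|z - S z|^2 >= 0] bounds the quotient by [(1 + c) / 2]. *)
have EU : has_ubound E.
  exists (1 + c) => _ [z z1 ->]; have := dotxx_ge0 (z - S *m z).
  have := Hc z; have := dotxx_ge0 (S *m z); rewrite /form !dotL z1 (dotC (S *m z) z).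
  by move=> H1 H2 H3; nra.
have hE : has_sup E by [].
set rho := sup E.
suff Hrho : eigenvalue S rho.
  have xx : 0 < dot x x by rewrite dotxx_gt0.
  have : (dot x x)^-1 * form S x x <= rho.
    by apply: ub_le_sup => //; exact: unit_scale.
  rewrite mulrC ler_pdivrMr // => /le_trans; apply.
  by apply: ler_wpM2r; [exact: ltW|exact: Hl].
apply: contraT => nE.
pose N := rho%:M - S.
have sN : N^T = N by rewrite /N linearB /= tr_scalar_mx sS.
have pN : psd N.
  split=> // z; rewrite /N formB form_scalar subr_ge0.
  have [->|z0] := eqVneq z 0; first by rewrite form0l dot0l mulr0.
  have zz : 0 < dot z z by rewrite dotxx_gt0.
  rewrite -ler_pdivrMr // mulrC.
  by apply: ub_le_sup => //; exact: unit_scale.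
have uN : N \in unitmx.
  move: nE; rewrite /eigenvalue negbK /eigenspace kermx_eq0 row_free_unit.
  rewrite /N -[S - _]opprB -scaleN1r unitmxZ // unitrN unitr1 //.
have [c1 c10 Hc1] := mulmx_bounded (invmx N).
have [c2 c20 Hc2] := mulmx_bounded N.
(* Invertibility gives [|z|^2 <= c1 |N z|^2], and positivity of [N] gives
   [|N z|^2 <= (1 + c2) <z, N z>]. *)
have low z : dot z z <= c1 * (1 + c2) * form N z z.
  have H1 := Hc1 (N *m z); rewrite mulKmx // in H1.
  apply: le_trans H1 _; rewrite -mulrA ler_pM2l //.
  apply: psd_sqr_le => // y; have := Hc2 y; have := dotxx_ge0 (y - N *m y).
  rewrite /form !dotL (dotC (N *m y) y).
  have := dotxx_ge0 (N *m y); have := dotxx_ge0 y; move=> H3 H4 H5 H6; nra.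
set k := c1 * (1 + c2) in low.
have k0 : 0 < k by rewrite mulr_gt0 // addr_gt0.
have : rho <= rho - k^-1.
  apply: ge_sup => // _ [z z1 ->]; have := low z.
  rewrite /N formB form_scalar z1 mulr1 -ler_pdivrMl // mulr1.
  by move=> H; lra.
by rewrite lerBrDr gerDl leNgt invr_gt0 k0.
Qed.

End Form.
End Forms.

(** * Deterministic building blocks *)

Section Deterministic.
Variable R : realType.

Lemma drawless_discrete X (c : algo R X) : drawless c -> discrete c.
Proof. by elim: c => //= [oo k IH|r k IH]; exact: IH. Qed.

Lemma computes_op oo : computes (op oo) (arith_val oo : R).
Proof. by []. Qed.

Section Vectors.
Variable d : nat.
Implicit Types x y : 'cV[R]_d.

Lemma drawless_vadd x y : drawless (vadd x y).
Proof. exact: drawless_build. Qed.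
Lemma drawless_vsub x y : drawless (vsub x y).
Proof. exact: drawless_build. Qed.
Lemma drawless_vscale c x : drawless (vscale c x).
Proof. exact: drawless_build. Qed.

Lemma computes_vadd x y : computes (vadd x y) (x + y).
Proof. exact: runs_computes (drawless_vadd _ _) (runs_vadd _ _). Qed.
Lemma computes_vsub x y : computes (vsub x y) (x - y).
Proof. exact: runs_computes (drawless_vsub _ _) (runs_vsub _ _). Qed.
Lemma computes_vscale c x : computes (vscale c x) (c *: x).
Proof. exact: runs_computes (drawless_vscale _ _) (runs_vscale _ _). Qed.

Lemma runs_sumsq x : runs (sumsq x) (2 * d) (eq^~ (dot x x)).
Proof.
have := @runs_loop _ _ _ (fun s r => r + \sum_(j <- s) x j 0 * x j 0 = dot x x)
  (fun=> 2%N) (fun j s => q <- op (RMul (x j 0) (x j 0));; op (RAdd s q))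
  (enum 'I_d) 0.
rewrite big_const_seq count_predT iter_addn_0 size_enum_ord.
move=> H; apply: (runs_weaken (leqnn _) _ (H _ _)); clear H.
- by move=> r; rewrite big_nil addr0.
- by move=> j s r /=; rewrite big_cons addrA.
- by rewrite add0r big_enum.
Qed.

Lemma drawless_sumsq x : drawless (sumsq x).
Proof. by apply: drawless_loop => j s; exact: drawless_bind. Qed.

Lemma drawless_normalize x : drawless (normalize x).
Proof.
apply: drawless_bind => [|s]; first exact: drawless_sumsq.
rewrite /=; case: (s == 0) => //=; exact: drawless_vscale.
Qed.

Lemma enorm_sqrt_dot_inv x : x != 0 -> enorm ((Num.sqrt (dot x x))^-1 *: x) = 1.
Proof.
move=> x0; rewrite enormE dotZl dotZr mulrA -expr2 exprVn sqr_sqrtr ?dotxx_ge0 //.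
by rewrite mulVf ?sqrtr1 // dotxx_eq0.
Qed.

Lemma runs_normalize x : (0 < d)%N ->
  runs (normalize x) (3 * d + 3)
    (fun z => enorm z = 1 /\ (x != 0 -> z = (Num.sqrt (dot x x))^-1 *: x)).
Proof.
move=> d0; rewrite [X in runs _ X _](_ : _ = 2 * d + (d.+3))%N; last first.
  by lia.
apply: runs_bind (runs_sumsq _) _ => _ -> /=.
have [x0|x0] /= := eqVneq (dot x x) 0.
  move/eqP: x0; rewrite dotxx_eq0 => /eqP ->; split; last by rewrite eqxx.
  case: d d0 => // d' _; rewrite enormE /dot big_ord_recl big1 => [|j _].
    by rewrite !mxE mulr1 addr0 sqrtr1.
  by rewrite !mxE mulr0.
apply: runs_weaken (leqnn _) _ (runs_vscale _ _) => _ ->; rewrite div1r.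
by split=> //; apply: enorm_sqrt_dot_inv; rewrite -dotxx_eq0.
Qed.

End Vectors.

Section Rows.
Variables (n d : nat) (A : 'M[R]_(n, d)).

Definition sqnorms : 'cV[R]_n := \col_i \sum_j A i j ^+ 2.

Lemma drawless_row_dot i x : drawless (row_dot A i x).
Proof. by apply: drawless_loop => j s; exact: drawless_bind. Qed.

Lemma drawless_row_subtract i c x : drawless (row_subtract A i c x).
Proof. by apply: drawless_loop => j s; exact: drawless_bind. Qed.

Lemma drawless_grad sh h w : drawless (grad A sh h w).
Proof.
apply: drawless_bind => [|?]; first exact: drawless_vscale.
apply: drawless_bind => [|?]; first exact: drawless_vsub.
apply: drawless_loop => i g; apply: drawless_bind => [|?].
  exact: drawless_row_dot.
exact: drawless_row_subtract.
Qed.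

Lemma computes_row_dot i x : computes (row_dot A i x) ((A *m x) i 0).
Proof. exact: runs_computes (drawless_row_dot _ _) (runs_row_dot _ _ _). Qed.

Lemma computes_row_subtract i c x :
  computes (row_subtract A i c x) (x - c *: (row i A)^T).
Proof.
exact: runs_computes (drawless_row_subtract _ _ _) (runs_row_subtract _ _ _ _).
Qed.

Lemma computes_grad sh h w : computes (grad A sh h w) (shifted A sh *m w - h).
Proof. exact: runs_computes (drawless_grad _ _ _) (runs_grad _ _ _ _). Qed.

Lemma drawless_row_weights : drawless (row_weights A).
Proof.
by apply: drawless_loop => i WF; apply: drawless_loop => j WF';
  do 3![apply: drawless_bind => //= ?].
Qed.

Lemma sum_row_support i (f : R -> R) : f 0 = 0 ->
  \sum_(j <- row_support A i) f (A i j) = \sum_j f (A i j).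
Proof.
move=> f0; rewrite /row_support big_filter big_enum_cond /=.
rewrite [RHS](bigID (fun j => A i j != 0)) /= [X in _ + X]big1 ?addr0 // => j.
by rewrite negbK => /eqP ->.
Qed.

Lemma runs_row_weights :
  runs (row_weights A) (3 * nnz A) (eq^~ (sqnorms, frobenius2 A)).
Proof.
(* [s] lists the rows still to be visited: their weights are 0, the other weights are final, and the
   total lacks exactly the rows of [s]. *)
pose P (s : seq 'I_n) (WF : 'cV[R]_n * R) := uniq s /\
  (forall k, WF.1 k 0 = if k \in s then 0 else \sum_j A k j ^+ 2) /\
  WF.2 + \sum_(k <- s) \sum_j A k j ^+ 2 = frobenius2 A.
have := @runs_loop _ _ _ P (fun i => 3 * size (row_support A i))%N
  (fun i => loop (row_support A i)
      (fun j (WF : 'cV[R]_n * R) =>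
         q <- op (RMul (A i j) (A i j));;
         r <- op (RAdd (WF.1 i 0) q);;
         F <- op (RAdd WF.2 q);; Ret R (setv WF.1 i r, F))) (enum 'I_n) (0, 0).
have -> : (\sum_(i <- enum 'I_n) 3 * size (row_support A i) = 3 * nnz A)%N.
  by rewrite nnzE big_distrr /= big_enum.
move=> H; apply: (runs_weaken (leqnn _) _ (H _ _)); clear H.
- move=> [W F] [_ [/= HW]]; rewrite big_nil addr0 => <-.
  by congr (_, _); apply/colP => i; rewrite HW mxE.
- move=> i s [W F] [/= /andP[is_ us] [HW HF]].
  pose Q (t : seq 'I_d) (WF : 'cV[R]_n * R) :=
    (forall k, k != i -> WF.1 k 0 = W k 0) /\
    WF.1 i 0 + \sum_(j <- t) A i j ^+ 2 = \sum_j A i j ^+ 2 /\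
    WF.2 + \sum_(j <- t) A i j ^+ 2 = F + \sum_j A i j ^+ 2.
  have := @runs_loop _ _ _ Q (fun=> 3%N) (fun j (WF : 'cV[R]_n * R) =>
         q <- op (RMul (A i j) (A i j));;
         r <- op (RAdd (WF.1 i 0) q);;
         F <- op (RAdd WF.2 q);; Ret R (setv WF.1 i r, F))
      (row_support A i) (W, F).
  rewrite big_const_seq count_predT iter_addn_0.
  move=> H; apply: (runs_weaken (leqnn _) _ (H _ _)); clear H.
  + move=> [W' F'] [/= H1]; rewrite big_nil !addr0 => -[H2 H3]; split=> //=.
    split=> [k|].
      have [->|ki] := eqVneq k i; first by rewrite H2 (negbTE is_).
      by rewrite H1 // HW inE (negbTE ki).
    by rewrite H3 -HF big_cons addrA.
  + move=> j t [W' F'] [/= H1 [H2 H3]]; rewrite big_cons in H2 H3.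
    split=> [k ki|] /=; first by rewrite mxE (negbTE ki) H1.
    by rewrite mxE eqxx -!addrA -expr2 H2 H3.
  + split=> //=; rewrite HW inE eqxx add0r.
    by rewrite (@sum_row_support i (fun r => r ^+ 2)) // expr0n.
- split; first exact: enum_uniq.
  split=> [k|] /=; first by rewrite mem_enum mxE.
  by rewrite add0r big_enum.
Qed.

Lemma computes_row_weights : computes (row_weights A) (sqnorms, frobenius2 A).
Proof. exact: runs_computes drawless_row_weights runs_row_weights. Qed.

Lemma sum_sqnorms : \sum_i sqnorms i 0 = frobenius2 A.
Proof. by apply: eq_bigr => i _; rewrite mxE. Qed.

Lemma sqnorms_ge0 i : 0 <= sqnorms i 0.
Proof. by rewrite mxE sumr_ge0 // => j _; exact: sqr_ge0. Qed.

Lemma sqnorms_dot i : sqnorms i 0 = dot (row i A)^T (row i A)^T.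
Proof. by rewrite dot_rowrow mxE. Qed.

Lemma frobenius2_ge0 : 0 <= frobenius2 A.
Proof. by rewrite -sum_sqnorms sumr_ge0 // => i _; exact: sqnorms_ge0. Qed.

Lemma frobenius2_gt0 : A != 0 -> 0 < frobenius2 A.
Proof.
apply: contra_neqT; rewrite -leNgt -sum_sqnorms => H.
have /eqP : \sum_i sqnorms i 0 = 0.
  by apply/eqP; rewrite eq_le H sumr_ge0 // => i _; exact: sqnorms_ge0.
rewrite psumr_eq0 => [/allP H0|i _]; last exact: sqnorms_ge0.
apply/row_matrixP => i; have := H0 i (mem_index_enum i).
rewrite sqnorms_dot dotxx_eq0 => /eqP /(congr1 trmx).
by rewrite trmxK trmx0 row0.
Qed.

End Rows.
End Deterministic.

(** * Stochastic variance reduction *)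

Section SVRG.
Variables (R : realType) (n d : nat) (A : 'M[R]_(n, d)) (lam1 : R).
Hypothesis A0 : A != 0.
Hypothesis lam1_top : forall x, form (A^T *m A) x x <= lam1 * dot x x.

Local Notation Sg := (A^T *m A).
Local Notation F := (frobenius2 A).
Local Notation W := (sqnorms A).

(** Some column [A e_j] is nonzero, and [|A e_j|^2] is the Gram form at [e_j]. *)
Lemma rayleigh_top_gt0 : 0 < lam1.
Proof.
have [j Aj] : exists j, col j A != 0.
  apply/existsP; apply: contraNT A0; rewrite negb_exists => /forallP H.
  apply/eqP/trmx_inj/row_matrixP => j; rewrite -tr_col.
  by have := H j; rewrite negbK => /eqP ->; rewrite !trmx0 row0.
have e0 : 0 < dot (delta_mx j 0 : 'cV[R]_d) (delta_mx j 0).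
  rewrite dotxx_gt0; apply/eqP => /colP /(_ j) /eqP.
  by rewrite !mxE !eqxx oner_eq0.
rewrite -(pmulr_lgt0 _ e0); apply: lt_le_trans (lam1_top _).
by rewrite form_gram -colE dotxx_gt0.
Qed.

Lemma rayleigh_top_ge0 : 0 <= lam1.
Proof. exact: ltW rayleigh_top_gt0. Qed.

Variable sh : R.
Local Notation M := (shifted A sh).
Local Notation kap := (sh - lam1).

Lemma shifted_sym : M^T = M.
Proof. by rewrite /shifted linearB /= tr_scalar_mx gram_sym. Qed.

Lemma shifted_ge x : kap * dot x x <= form M x x.
Proof. by rewrite /shifted formB form_scalar mulrBl lerB // lam1_top. Qed.

Lemma shifted_le x : form M x x <= sh * dot x x.
Proof.
by rewrite /shifted formB form_scalar gerBl form_gram dotxx_ge0.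
Qed.

Lemma draw_sqnorms f :
  \sum_i W i 0 / (\sum_j W j 0) * f i = F^-1 * \sum_i W i 0 * f i.
Proof.
by rewrite sum_sqnorms big_distrr; apply: eq_bigr => i _ /=; rewrite mulrAC mulrC.
Qed.

(** The value returned by [svrg_step] when row [i] is drawn. For a zero row, which has probability
    0, the quotient [F / W i 0] is 0. *)
Definition svrg_next eta (w g x : 'cV[R]_d) i :=
  x - eta *: (sh *: (x - w) + g
              - (F / W i 0 * (A *m (x - w)) i 0) *: (row i A)^T).

Lemma expect_svrg_step eta w g x f :
  expect (svrg_step A W F sh eta w g x) f =
  F^-1 * \sum_i W i 0 * f (svrg_next eta w g x i).
Proof.
rewrite -draw_sqnorms /=; apply: eq_bigr => i _; congr (_ * _).
rewrite (expect_computes _ _ (computes_vsub _ _)).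
rewrite (expect_computes _ _ (computes_row_dot _ _ _)) /=.
rewrite (expect_computes _ _ (computes_vscale _ _)).
rewrite (expect_computes _ _ (computes_vadd _ _)).
rewrite (expect_computes _ _ (computes_row_subtract _ _ _ _)).
rewrite (expect_computes _ _ (computes_vscale _ _)).
by have := @expect_computes _ _ _ _ (@Ret R _) _ f (computes_vsub x _) => /= <-;
  rewrite expect_bind.
Qed.

Lemma discrete_svrg_step eta w g x : discrete (svrg_step A W F sh eta w g x).
Proof.
split=> [i||i]; first exact: sqnorms_ge0.
  by rewrite sum_sqnorms frobenius2_gt0.
apply: drawless_discrete.
apply: drawless_bind => [|u]; first exact: drawless_vsub.
apply: drawless_bind => [|c]; first exact: drawless_row_dot.
apply: drawless_bind => [//|ip]; apply: drawless_bind => [//|q].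
apply: drawless_bind => [|su]; first exact: drawless_vscale.
apply: drawless_bind => [|v]; first exact: drawless_vadd.
apply: drawless_bind => [|v']; first exact: drawless_row_subtract.
apply: drawless_bind => [|ev]; first exact: drawless_vscale.
exact: drawless_vsub.
Qed.

(* The centered part of the stochastic gradient has second moment
   [F <u, Sg u> - |Sg u|^2]. *)
Lemma svrg_step_sqdist eta (w g x e : 'cV[R]_d) :
  let u := x - w in
  sh *: u + g = M *m e + Sg *m u ->
  F^-1 * \sum_i W i 0 * dot (svrg_next eta w g x i - (x - e))
                            (svrg_next eta w g x i - (x - e)) <=
  dot e e - 2 * eta * form M e e
    + eta ^+ 2 * (dot (M *m e) (M *m e) + F * form Sg u u).
Proof.
move=> u; set c := sh *: u + g => Hc.
have F0 : F != 0 by rewrite gt_eqF // frobenius2_gt0.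
have nextE i : svrg_next eta w g x i - (x - e) =
    e - eta *: (c - (F / W i 0 * (A *m u) i 0) *: (row i A)^T).
  by rewrite /svrg_next -/u -/c opprB addrCA addrAC subrr add0r addrC.
clearbody c; clearbody u.
(* The weight cancels every denominator because [|a_i|^2 = W_i]; what remains sums over [i] to inner
   products of [A u], [A e] and [A c]. *)
have Wterm i : W i 0 * dot (svrg_next eta w g x i - (x - e))
                            (svrg_next eta w g x i - (x - e)) =
   W i 0 * (dot e e - 2 * eta * dot e c + eta ^+ 2 * dot c c)
   + F * (2 * eta * ((A *m u) i 0 * (A *m e) i 0)
          - 2 * eta ^+ 2 * ((A *m u) i 0 * (A *m c) i 0)
          + eta ^+ 2 * F * ((A *m u) i 0 * (A *m u) i 0)).
  set a := (row i A)^T.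
  rewrite nextE -!dot_row -/a sqnorms_dot -/a; clearbody a.
  have [a0|a0] := eqVneq a 0.
    by rewrite a0 !dot0l !mul0r !(mulr0, subr0, addr0).
  have aa : dot a a != 0 by rewrite dotxx_eq0.
  rewrite !dotL (dotC c e) (dotC e a) (dotC c a).
  by field.
rewrite (eq_bigr _ (fun i _ => Wterm i)) big_split /= -big_distrl -big_distrr /=.
rewrite sum_sqnorms mulrDr !mulKf //.
rewrite !big_split /= sumrN -!big_distrr /=.
rewrite -[\sum_i _ * (A *m e) i 0]/(dot (A *m u) (A *m e)).
rewrite -[\sum_i _ * (A *m c) i 0]/(dot (A *m u) (A *m c)).
rewrite -[\sum_i _ * (A *m u) i 0]/(dot (A *m u) (A *m u)).
rewrite -!(form_gram A).
have -> : dot e c = form M e e + form Sg u e.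
  by rewrite Hc dotDr -/(form M e e) -/(form Sg e u) (form_sym e u (gram_sym A)).
have -> : dot c c = dot (M *m e) (M *m e) + 2 * dot (M *m e) (Sg *m u)
     + dot (Sg *m u) (Sg *m u).
  by rewrite Hc !dotL (dotC (Sg *m u) (M *m e)); ring.
have -> : form Sg u c = dot (M *m e) (Sg *m u) + dot (Sg *m u) (Sg *m u).
  by rewrite (form_sym u c (gram_sym A)) /form Hc dotDl.
(* The exact value carries the extra term [- eta^2 |Sg u|^2], which is dropped. *)
have := mulr_ge0 (sqr_ge0 eta) (dotxx_ge0 (Sg *m u)).
by lra.
Qed.

Hypothesis kap0 : 0 < kap.

Lemma psd_shifted : psd M.
Proof.
split=> [|x]; first exact: shifted_sym.
by apply: le_trans (shifted_ge x); rewrite mulr_ge0 ?dotxx_ge0 // ltW.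
Qed.

Lemma unit_shifted : M \in unitmx.
Proof. exact: posdef_unit shifted_sym kap0 shifted_ge. Qed.

Variables (h : 'cV[R]_d) (w : 'cV[R]_d).
Local Notation xs := (invmx M *m h).
Local Notation g := (M *m w - h).

(** Twice the gap between the objective at [x] and its minimum. *)
Definition energy x : R := form M (x - xs) (x - xs).

Lemma mulmx_sol : M *m xs = h.
Proof. by rewrite mulKVmx // unit_shifted. Qed.

Lemma energy_ge0 x : 0 <= energy x.
Proof. exact: psd_shifted.2. Qed.

Local Notation sig := (sh + 2 * F * lam1 / kap).

(** [sig] collects both second-moment terms: [|M e|^2 <= sh <e, M e>], and [F lam1 |x - w|^2 <= (2 F
    lam1 / kap) (energy x + energy w)] by passing through the solution [xs]. *)
Lemma svrg_step_decrease eta x :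
  expect (svrg_step A W F sh eta w g x) (fun x => dot (x - xs) (x - xs)) <=
  dot (x - xs) (x - xs) - 2 * eta * energy x
   + eta ^+ 2 * sig * (energy x + energy w).
Proof.
rewrite expect_svrg_step.
have := @svrg_step_sqdist eta w g x (x - xs); rewrite subKr /=.
have Hc : sh *: (x - w) + g = M *m (x - xs) + Sg *m (x - w).
  rewrite !mulmxBr mulmx_sol /shifted !mulmxBl !mul_scalar_mx scalerBr.
  set p := sh *: x; set q := sh *: w; set a := Sg *m x; set b := Sg *m w.
  by apply/colP => j; rewrite !mxE; ring.
move/(_ Hc)/le_trans; apply; rewrite -/(energy x) -addrA -addrA lerD2l lerD2l.
rewrite -mulrA ler_wpM2l ?sqr_ge0 //.
have H1 := psd_sqr_le (x - xs) psd_shifted shifted_le; rewrite -/(energy x) in H1.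
have H2 := lam1_top (x - w).
have H3 := shifted_ge (x - xs); rewrite -/(form M _ _) -/(energy x) in H3.
have H4 := shifted_ge (w - xs); rewrite -/(form M _ _) -/(energy w) in H4.
have H5 : dot (x - w) (x - w) <=
    2 * dot (x - xs) (x - xs) + 2 * dot (w - xs) (w - xs).
  have := @dot_sqrD R d (x - xs) (- (w - xs)) 1 1 ltr01 (mulr1 _).
  rewrite [dot (- (w - xs)) _]dotNl dotNr opprK opprB addrA subrK => H5.
  by lra.
have F0 := ltW (frobenius2_gt0 A0).
have E0 := energy_ge0 x; have E1 := energy_ge0 w.
have sh0 : 0 <= sh by have := rayleigh_top_ge0; have := ltW kap0; lra.
have H6 : form Sg (x - w) (x - w) <= 2 * lam1 / kap * (energy x + energy w).
  apply: le_trans H2 _; rewrite [2 * lam1]mulrC -!mulrA ler_wpM2l ?rayleigh_top_ge0 //.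
  apply: le_trans H5 _; rewrite -mulrDr ler_pM2l // mulrC ler_pdivlMr //.
  by rewrite mulrC mulrDr lerD.
have H7 := ler_wpM2l F0 H6.
have H8 := mulr_ge0 sh0 E1.
apply: le_trans (lerD H1 H7) _.
have -> : sig * (energy x + energy w) = sh * energy x + sh * energy w
   + F * (2 * lam1 / kap * (energy x + energy w)) by field; rewrite gt_eqF.
by lra.
Qed.

(* [Q] is a ghost for the sum of the energies of the [k] iterates summed in
   [s]; Jensen's inequality is applied one iterate at a time. *)
Lemma svrg_inner eta (D := 2 * eta - eta ^+ 2 * sig) j k x s Q :
  0 < D -> 0 <= Q ->
  form M (s - k%:R *: xs) (s - k%:R *: xs) <= k%:R * Q ->
  expect (repeat j (fun xs : 'cV[R]_d * 'cV[R]_d =>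
    s <- vadd xs.2 xs.1;;
    x <- svrg_step A W F sh eta w g xs.1;;
    Ret R (x, s)) (x, s))
    (fun p => form M (p.2 - (k + j)%:R *: xs) (p.2 - (k + j)%:R *: xs)) <=
  (k + j)%:R * (Q + (dot (x - xs) (x - xs)
                     + j%:R * (eta ^+ 2 * sig * energy w)) / D).
Proof.
move=> D0; elim: j k x s Q => [|j IH] k x s Q Q0 HQ.
  rewrite /= addn0 mul0r addr0; apply: le_trans HQ _.
  by rewrite ler_wpM2l ?ler0n // lerDl divr_ge0 ?dotxx_ge0 // ltW.
rewrite repeatS expect_bind.
rewrite (expect_computes _ _ (computes_vadd _ _)) expect_bind.
have Ex := energy_ge0 x.
(* Jensen's step: [<a, M b>^2 <= k Q energy x] yields [2 <a, M b> <= Q + k energy x], and the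
   squares add at most [k Q + energy x]. *)
have HQ' : form M (s + x - k.+1%:R *: xs) (s + x - k.+1%:R *: xs)
           <= k.+1%:R * (Q + energy x).
  have -> : s + x - k.+1%:R *: xs = (s - k%:R *: xs) + (x - xs).
    by rewrite -natr1 scalerDl scale1r opprD addrACA.
  move: HQ; set a := s - _; set b := x - _ => HQ.
  have Eb : form M b b = energy x by [].
  clearbody a b.
  have := psd_CS a b psd_shifted.
  rewrite !formE (form_sym b a shifted_sym) Eb.
  move: (psd_shifted.2 a) HQ; set p := form M a a; set q := form M a b => p0 HQ Hq.
  have k0 : 0 <= k%:R :> R by [].
  rewrite -natr1.
  have H1 : q ^+ 2 <= k%:R * Q * energy x.
    by apply: le_trans Hq _; rewrite ler_wpM2r.
  have H2 : 2 * q <= Q + k%:R * energy x.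
    have t0 : 0 <= Q + k%:R * energy x by rewrite addr_ge0 // mulr_ge0.
    rewrite -[leRHS]ger0_norm // (le_trans (ler_norm _)) //.
    rewrite -ler_sqr ?nnegrE ?normr_ge0 // !real_normK ?num_real //.
    have := sqr_ge0 (Q - k%:R * energy x).
    by move=> H2; lra.
  by lra.
have dS := discrete_svrg_step eta w g x.
set K := eta ^+ 2 * sig * energy w.
rewrite addnS -addSn.
apply: le_trans (le_expect dS (fun y =>
  IH k.+1 y (s + x) (Q + energy x) (addr_ge0 Q0 Ex) HQ')) _.
rewrite expectZ ler_wpM2l // -/K.
have -> : (fun y => Q + energy x + (dot (y - xs) (y - xs) + j%:R * K) / D) =
   (fun y => (Q + energy x + j%:R * K / D) + D^-1 * dot (y - xs) (y - xs)).
  by apply/funext => y; field; rewrite gt_eqF.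
rewrite expectD expectZ expect_cst //.
(* The sum telescopes: the expected drop [D * energy x] of the squared distance pays for the
   [energy x] added to [Q]. *)
have := svrg_step_decrease eta x; set E := expect _ _ => HE.
have -> : Q + (dot (x - xs) (x - xs) + j.+1%:R * K) / D =
   Q + energy x + j%:R * K / D +
   D^-1 * (dot (x - xs) (x - xs) - D * energy x + K).
  by rewrite -natr1; field; rewrite gt_eqF.
rewrite lerD2l ler_pM2l ?invr_gt0 //; apply: le_trans HE _.
by rewrite /D /K; lra.
Qed.

Lemma discrete_svrg_epoch eta m :
  discrete (svrg_epoch A W F sh eta m h w).
Proof.
apply: discrete_computes (computes_grad _ _ _ _) _.
apply: discrete_bind => [|p].
  apply: discrete_repeat => p; apply: discrete_bind => [|s].
    exact/drawless_discrete/drawless_vadd.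
  by apply: discrete_bind => [|//]; exact: discrete_svrg_step.
by apply: drawless_discrete => /=; exact: drawless_vscale.
Qed.

(** Here [D = 15/8 eta], and strong convexity with [m eta kap >= 64 sig eta = 8] bounds the distance
    term by [energy w / 8]. The average has energy at most [8/15 (1/8 + 1/8) energy w], below a
    quarter. *)
Lemma svrg_epoch_contract eta m :
  eta * sig = 8^-1 -> 64 * sig / kap <= m%:R -> (0 < m)%N ->
  expect (svrg_epoch A W F sh eta m h w) energy <= 4^-1 * energy w.
Proof.
move=> eta_sig Hm m0.
have F0 := frobenius2_gt0 A0; have l0 := rayleigh_top_gt0.
have sh0 : 0 < sh by move: kap0; lra.
have sig0 : 0 < sig by rewrite addr_gt0 // divr_gt0 // !mulr_gt0.
have eta0 : 0 < eta by rewrite -(pmulr_lgt0 _ sig0) eta_sig invr_gt0.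
have DE : 2 * eta - eta ^+ 2 * sig = 15 / 8 * eta.
  by rewrite expr2 -mulrA eta_sig; field.
have D0 : 0 < 2 * eta - eta ^+ 2 * sig by rewrite DE mulr_gt0.
have mR : 0 < m%:R :> R by rewrite ltr0n.
rewrite /svrg_epoch (expect_computes _ _ (computes_grad _ _ _ _)) expect_bind.
have -> : (fun xs0 : 'cV[R]_d * 'cV[R]_d =>
    expect (c <- op (RDiv 1 m%:R);; vscale c xs0.2) energy) =
   (fun p => m%:R ^- 2 * form M (p.2 - (0 + m)%:R *: xs) (p.2 - (0 + m)%:R *: xs)).
  apply/funext => p /=.
  rewrite -[vscale _ _](@bind_ret R) (expect_computes _ _ (computes_vscale _ _)) /=.
  rewrite /energy add0n div1r.
  have -> : m%:R^-1 *: p.2 - xs = m%:R^-1 *: (p.2 - m%:R *: xs).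
    by rewrite scalerBr scalerA mulVf ?scale1r // gt_eqF.
  by rewrite formZl formZr mulrA -expr2 exprVn.
rewrite expectZ.
have H0 : form M (0 - 0%:R *: xs) (0 - 0%:R *: xs) <= 0%:R * 0.
  by rewrite scale0r subr0 form0l mul0r.
have := @svrg_inner eta m 0 w 0 0 D0 (lexx 0) H0.
rewrite add0n add0r DE => Hin.
have m2 : 0 <= m%:R ^- 2 :> R by rewrite invr_ge0 exprn_ge0.
apply: le_trans (ler_wpM2l m2 Hin) _.
have H4 := shifted_ge (w - xs); rewrite -/(energy w) in H4.
have E0 := energy_ge0 w.
have -> : m%:R ^- 2 * (m%:R * ((dot (w - xs) (w - xs)
      + m%:R * (eta ^+ 2 * sig * energy w)) / (15 / 8 * eta))) =
   8 / 15 * (dot (w - xs) (w - xs) / (m%:R * eta) + (eta * sig) * energy w).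
  by field; rewrite !gt_eqF.
rewrite eta_sig.
have H5 : dot (w - xs) (w - xs) / (m%:R * eta) <= 8^-1 * energy w.
  rewrite ler_pdivrMr ?mulr_gt0 // -(ler_pM2l kap0); apply: le_trans H4 _.
  have : 64 * sig <= m%:R * kap by rewrite -ler_pdivrMr.
  move/(ler_wpM2r (ltW eta0)).
  have -> : 64 * sig * eta = 64 * (eta * sig) by ring.
  rewrite eta_sig => H.
  have := ler_wpM2r E0 H; lra.
by lra.
Qed.

End SVRG.

(** * Acceleration *)

Section ExactStep.
Variables (R : realType) (d : nat) (B : 'M[R]_d) (mu : R).
Hypothesis pB : psd B.
Hypothesis mu0 : 0 <= mu.
Hypothesis B_ge : forall x, mu * dot x x <= form B x x.

(* Errors are relative to the solution: [p] is the exact proximal point of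
   [y = p + c k] and [mu k] the gradient at [p]. *)
Lemma exact_prox_contract (p k v x v' : 'cV[R]_d) t c :
  B *m p = mu *: k -> 0 <= t <= 1 -> t ^+ 2 <= 2 * c * (1 - t ^+ 2) ->
  x = (1 + t) *: (p + c *: k) - t *: v ->
  v' = (1 - t) *: v + t *: (p - k) ->
  form B p p + mu * dot v' v' <= (1 - t) * (form B x x + mu * dot v v).
Proof.
move=> Bp /andP[t0 t1] tc xE v'E.
(* The two sides differ by exactly the sum of [H1'], [H2'], [H3] and [H4]: the energy of [x - p],
   the strong convexity of [B] at [p], the convexity defect of the squared norm in [v'], and the
   slack in the condition on [t] and [c]. *)
have H1 : 0 <= form B (x - p) (x - p) by exact: pB.2.
have xp : form B x p = mu * ((1 + t) * (dot p k + c * dot k k) - t * dot v k).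
  by rewrite /form Bp xE !dotL; ring.
have pp : form B p p = mu * dot p k by rewrite /form Bp dotZr.
have -> : dot v' v' = (1 - t) ^+ 2 * dot v v + 2 * t * (1 - t) * (dot p v - dot v k)
   + t ^+ 2 * (dot p p - 2 * dot p k + dot k k).
  by rewrite v'E !dotL (dotC v p) (dotC k p) (dotC k v); ring.
rewrite !formE (form_sym p x pB.1) xp pp in H1.
have H1' : 0 <= (1 - t) * (form B x x
    - 2 * (mu * ((1 + t) * (dot p k + c * dot k k) - t * dot v k))
    + mu * dot p k).
  by apply: mulr_ge0; lra.
have H2 := B_ge p; rewrite pp in H2.
have H2' : 0 <= t * (mu * dot p k - mu * dot p p) by apply: mulr_ge0; lra.
have H3 : 0 <= mu * (t * (1 - t)) * dot (v - p) (v - p).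
  by rewrite !mulr_ge0 ?dotxx_ge0 //; lra.
rewrite !dotL (dotC v p) in H3.
have H4 : 0 <= mu * dot k k * (2 * c * (1 - t ^+ 2) - t ^+ 2).
  by rewrite !mulr_ge0 ?dotxx_ge0 //; lra.
rewrite pp; lra.
Qed.

End ExactStep.

(** * Accelerated steps with an inexact proximal solver *)

Section Accel.
Variables (R : realType) (n d : nat) (A : 'M[R]_(n, d)) (lam1 lam gam : R).
Hypothesis A0 : A != 0.
Hypothesis lam1_top : forall x, form (A^T *m A) x x <= lam1 * dot x x.
Hypothesis mu0 : 0 < lam - lam1.
Hypothesis gam0 : 0 < gam.

Local Notation F := (frobenius2 A).
Local Notation W := (sqnorms A).
Local Notation mu := (lam - lam1).
Local Notation kap := (lam + gam - lam1).
Local Notation B := (shifted A lam).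
Local Notation M := (shifted A (lam + gam)).
Local Notation t := (Num.sqrt (mu / kap)).

Variable P : params R.
Hypothesis P_reg : regularizer P = gam.
Hypothesis P_mix : mixing P = t / (1 + t).
Hypothesis P_mom : momentum P = t.
Hypothesis P_dual : dual_step P = 1 + gam / mu.
Hypothesis P_step : step_size P * (lam + gam + 2 * F * lam1 / kap) = 8^-1.
Hypothesis P_len : 64 * (lam + gam + 2 * F * lam1 / kap) / kap
                   <= (epoch_length P)%:R.
Hypothesis P_len0 : (0 < epoch_length P)%N.
Hypothesis P_epochs : 24 * (lam / mu) * 4^-1 ^+ epochs P <= mu / kap.

Variable b : 'cV[R]_d.
Local Notation xb := (invmx B *m b).

Lemma shift_reg_gt0 : 0 < kap.
Proof. by have := gam0; have := mu0; lra. Qed.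

Lemma formM x y : form M x y = form B x y + gam * dot x y.
Proof. by rewrite /shifted !formB !form_scalar; ring. Qed.

Lemma sol_B : B *m xb = b.
Proof. exact: (mulmx_sol lam1_top). Qed.

Lemma discrete_svrg_prox y : discrete (svrg_prox A P W F lam b y).
Proof.
apply: discrete_bind => [//|sh]; apply: discrete_bind => [|gy].
  exact/drawless_discrete/drawless_vscale.
apply: discrete_bind => [|h]; first exact/drawless_discrete/drawless_vadd.
by apply: discrete_repeat => w; exact: discrete_svrg_epoch.
Qed.

(** Besides the contraction over epochs, the initial energy must be compared with the [B]-energy of
    the error [e] of [y]. The distance [q] to the proximal point satisfies [M q = B e], so
    [<q, B q> <= <q, M q> = <q, B e>], and Cauchy-Schwarz bounds the latter by [<e, B e>]. *)
Lemma expect_svrg_prox y :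
  expect (svrg_prox A P W F lam b y) (energy A (lam + gam) (b + gam *: y)) <=
  4^-1 ^+ epochs P * form B (y - xb) (y - xb).
Proof.
have k0 := shift_reg_gt0.
rewrite /svrg_prox /= P_reg (expect_computes _ _ (computes_vscale _ _)).
rewrite (expect_computes _ _ (computes_vadd _ _)).
set h := b + gam *: y.
have q0 : 0 <= 4^-1 :> R by rewrite invr_ge0.
have dE w : discrete
    (svrg_epoch A W F (lam + gam) (step_size P) (epoch_length P) h w).
  exact: discrete_svrg_epoch.
apply: le_trans (expect_repeat (epochs P) y q0 dE (fun w =>
  svrg_epoch_contract A0 lam1_top k0 h w P_step P_len P_len0)) _.
rewrite ler_wpM2l ?exprn_ge0 ?invr_ge0 // /energy.
set q := y - _; set e := y - xb.
have Mq : M *m q = B *m e.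
  rewrite /q /e !mulmxBr sol_B (mulmx_sol lam1_top) // /h.
  rewrite /shifted !mulmxBl !mul_scalar_mx scalerDl.
  by apply/colP => j; rewrite !mxE; ring.
clearbody q e; rewrite {1}/form Mq -/(form B q e).
have pB := psd_shifted lam1_top mu0.
have CS := psd_CS q e pB.
have H1 : form B q q <= form B q e.
  rewrite -[form B q e]/(dot q (B *m e)) -Mq -/(form M q q) formM lerDl.
  by rewrite mulr_ge0 ?dotxx_ge0 // ltW.
have [z|z] := eqVneq (form B q e) 0; first by rewrite z; exact: pB.2.
have z0 : 0 < form B q e by rewrite lt_neqAle eq_sym z (le_trans _ H1) // pB.2.
rewrite -(ler_pM2l z0) -expr2; apply: le_trans CS _.
by rewrite ler_wpM2r // pB.2.
Qed.

Definition accel_potential (xv : 'cV[R]_d * 'cV[R]_d) : R :=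
  form B (xv.1 - xb) (xv.1 - xb) + mu * dot (xv.2 - xb) (xv.2 - xb).

Lemma accel_rate_bounds : 0 < t /\ t <= 1 /\ t ^+ 2 = mu / kap.
Proof.
have k0 := shift_reg_gt0; have m0 := mu0; have g0 := gam0.
have q0 : 0 < mu / kap by rewrite divr_gt0.
split; first by rewrite sqrtr_gt0.
split; last by rewrite sqr_sqrtr // ltW.
by rewrite -[leRHS]sqrtr1 ler_wsqrtr // ler_pdivrMr //; lra.
Qed.

Lemma discrete_accel_step xv : discrete (accel_step A P W F lam b xv).
Proof.
apply: discrete_bind => [//|a'].
apply: discrete_bind => [|y1]; first exact/drawless_discrete/drawless_vscale.
apply: discrete_bind => [|y2]; first exact/drawless_discrete/drawless_vscale.
apply: discrete_bind => [|y]; first exact/drawless_discrete/drawless_vadd.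
apply: discrete_bind => [|x]; first exact: discrete_svrg_prox.
apply: discrete_bind => [|yx]; first exact/drawless_discrete/drawless_vsub.
apply: discrete_bind => [|syx]; first exact/drawless_discrete/drawless_vscale.
apply: discrete_bind => [|z]; first exact/drawless_discrete/drawless_vsub.
apply: discrete_bind => [//|m'].
apply: discrete_bind => [|v1]; first exact/drawless_discrete/drawless_vscale.
apply: discrete_bind => [|v2]; first exact/drawless_discrete/drawless_vscale.
by apply: discrete_bind => [|v //]; first exact/drawless_discrete/drawless_vadd.
Qed.

Lemma expect_accel_step xv f : let y := (1 - mixing P) *: xv.1 + mixing P *: xv.2 in
  expect (accel_step A P W F lam b xv) f =
  expect (svrg_prox A P W F lam b y) (fun x => f (x,
    (1 - momentum P) *: xv.2 + momentum P *: (y - dual_step P *: (y - x)))).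
Proof.
move=> y; rewrite /accel_step (expect_computes _ _ (computes_op _)).
rewrite (expect_computes _ _ (computes_vscale _ _)).
rewrite (expect_computes _ _ (computes_vscale _ _)).
rewrite (expect_computes _ _ (computes_vadd _ _)) expect_bind.
apply: (f_equal (expect _)).
apply/funext => x; rewrite (expect_computes _ _ (computes_vsub _ _)).
rewrite (expect_computes _ _ (computes_vscale _ _)).
rewrite (expect_computes _ _ (computes_vsub _ _)).
rewrite (expect_computes _ _ (computes_op _)).
rewrite (expect_computes _ _ (computes_vscale _ _)).
rewrite (expect_computes _ _ (computes_vscale _ _)).
by rewrite (expect_computes _ _ (computes_vadd _ _)).
Qed.

(** Splitting off the inner error [r] with weight [t / 2] turns the exact rate [1 - t] into
    [(1 + t/2) (1 - t) <= 1 - t/2]; the number of epochs keeps the contribution of [r] below [t / 4]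
    of the potential. *)
Lemma accel_step_contract xv :
  expect (accel_step A P W F lam b xv) accel_potential
  <= (1 - t / 4) * accel_potential xv.
Proof.
have [t0 [t1 t2]] := accel_rate_bounds.
have k0 := shift_reg_gt0; have m0 := mu0; have g0 := gam0.
rewrite expect_accel_step P_mix P_mom P_dual.
case: xv => x v /=; set y := (1 - _) *: x + _.
set p := invmx M *m (b + gam *: y).
pose ey := y - xb; pose ex := x - xb; pose ev := v - xb; pose ep := p - xb.
have t1n : 1 + t != 0 by rewrite gt_eqF // addr_gt0.
have exE : ex = (1 + t) *: ey - t *: ev.
  by apply/colP => j; rewrite /ex /ey /ev /y !mxE; field.
have eyE : ey = (1 - t / (1 + t)) *: ex + (t / (1 + t)) *: ev.
  by apply/colP => j; rewrite /ex /ey /ev /y !mxE; field.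
have Mp : M *m p = b + gam *: y by exact: (mulmx_sol lam1_top).
have Bep : B *m ep = gam *: (ey - ep).
  rewrite /ep mulmxBr sol_B.
  have -> : B *m p = M *m p - gam *: p.
    by rewrite /shifted !mulmxBl !mul_scalar_mx scalerDl; apply/colP => j; rewrite !mxE; ring.
  by rewrite Mp /ey; apply/colP => j; rewrite !mxE; ring.
(* [mu k] is the gradient at the proximal point, and [dual_step] is such that an exact step moves
   [z] to the error [ep - k]. *)
pose k := (gam / mu) *: (ey - ep).
have Bk : B *m ep = mu *: k.
  by rewrite Bep /k scalerA; congr (_ *: _); field; rewrite gt_eqF.
have eyk : ey = ep + (mu / gam) *: k.
  rewrite /k scalerA; have -> : mu / gam * (gam / mu) = 1 by field; rewrite !gt_eqF.
  by rewrite scale1r addrC subrK.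
(* Since [1 - t^2 = gam / kap], the right-hand side is [2 t^2]. *)
have tc : t ^+ 2 <= 2 * (mu / gam) * (1 - t ^+ 2).
  have -> : 2 * (mu / gam) * (1 - t ^+ 2) = 2 * t ^+ 2.
    by rewrite t2; field; rewrite !gt_eqF.
  by have := sqr_ge0 t; lra.
have t01 : 0 <= t <= 1 by rewrite ltW.
have pB := psd_shifted lam1_top mu0.
pose v' := (1 - t) *: ev + t *: (ep - k).
have exE' := exE; rewrite eyk in exE'.
have Hex := exact_prox_contract pB (ltW mu0) (shifted_ge lam1_top lam) Bk t01 tc
  exE' (erefl v').
have Hx x' : accel_potential (x', (1 - t) *: v + t *: (y - (1 + gam / mu) *: (y - x')))
   <= (1 + t / 2) * (1 - t) * accel_potential (x, v)
      + (1 + 2 / t) * 2 * energy A (lam + gam) (b + gam *: y) x'.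
  rewrite /accel_potential /= -/ex -/ev /energy -/p.
  set r := x' - p.
  have -> : x' - xb = ep + r by rewrite [RHS]addrC /ep /r addrA subrK.
  have -> : (1 - t) *: v + t *: (y - (1 + gam / mu) *: (y - x')) - xb =
            v' + (t * (kap / mu)) *: r.
    rewrite /v' /k /r /ev /ep /ey; apply/colP => j; rewrite !mxE.
    by field; rewrite gt_eqF.
  have tt : t / 2 * (2 / t) = 1 by field; rewrite gt_eqF.
  have th0 : 0 < t / 2 by rewrite divr_gt0.
  have S1 := form_sqrD ep r pB th0 tt.
  have S2 := dot_sqrD v' ((t * (kap / mu)) *: r) th0 tt.
  rewrite [dot (_ *: r) _]dotZl dotZr in S2.
  (* The value [t^2 = mu / kap] makes the error in [v] weigh [kap |r|^2], which, like [form B r r],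
     is at most [form M r r]. *)
  have S3 : mu * (t * (kap / mu) * (t * (kap / mu) * dot r r)) = kap * dot r r.
    have -> : mu * (t * (kap / mu) * (t * (kap / mu) * dot r r)) =
      mu * t ^+ 2 * (kap / mu) ^+ 2 * dot r r by ring.
    by rewrite t2; field; rewrite !gt_eqF.
  have S4 : form B r r <= form M r r.
    by rewrite formM lerDl mulr_ge0 ?dotxx_ge0 // ltW.
  have S5 : kap * dot r r <= form M r r by exact: (shifted_ge lam1_top).
  have i0 : 0 <= 2 / t by rewrite divr_ge0 // ltW.
  have S6 := ler_wpM2l (ltW m0) S2.
  have Hex' := ler_wpM2l (addr_ge0 ler01 (ltW th0)) Hex.
  have S7 : (1 + 2 / t) * (form B r r + kap * dot r r) <=
            (1 + 2 / t) * (2 * form M r r).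
    by apply: ler_wpM2l; lra.
  have S8 : mu * ((1 + 2 / t) * (t * (kap / mu) * (t * (kap / mu) * dot r r)))
            = (1 + 2 / t) * (kap * dot r r) by rewrite -S3; ring.
  rewrite mulrDr S8 in S6.
  by lra.
apply: le_trans (le_expect (discrete_svrg_prox y) Hx) _.
rewrite expectD expect_cst ?expectZ; last exact: discrete_svrg_prox.
have Hp := expect_svrg_prox y.
(* [y] is a convex combination of [x] and [v]; the factor [lam / mu] appears because the potential
   measures [v] only in Euclidean norm. *)
have F0 : form B ey ey <= lam / mu * accel_potential (x, v).
  rewrite /accel_potential /= -/ex -/ev.
  set a := t / (1 + t) in eyE.
  have a0 : 0 <= a by rewrite divr_ge0 ?ltW // addr_gt0.
  have a1 : a <= 1 by rewrite ler_pdivrMr ?addr_gt0 // mul1r lerDr.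
  have Q1 := pB.2 (ex - ev).
  have Q2 := shifted_le A lam ev.
  have Q3 : form B ey ey <= form B ex ex + form B ev ev.
    rewrite eyE; clearbody ex ev.
    rewrite !formE (form_sym ev ex pB.1) in Q1 *.
    have := mulr_ge0 (mulr_ge0 a0 (_ : 0 <= 1 - a)) Q1; rewrite subr_ge0 => /(_ a1) Q4.
    have Q5 := mulr_ge0 a0 (pB.2 ex).
    have := mulr_ge0 (_ : 0 <= 1 - a) (pB.2 ev); rewrite subr_ge0 => /(_ a1) Q6.
    by lra.
  have lm : 1 <= lam / mu.
    rewrite ler_pdivlMr // mul1r lerBlDr lerDl.
    exact: rayleigh_top_ge0 A0 lam1_top.
  have Q7 := ler_wpM2r (pB.2 ex) lm.
  have Q8 : lam / mu * (mu * dot ev ev) = lam * dot ev ev.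
    by field; rewrite gt_eqF.
  by rewrite mulrDr Q8; lra.
have Phi0 : 0 <= accel_potential (x, v).
  by rewrite /accel_potential addr_ge0 ?pB.2 // mulr_ge0 ?dotxx_ge0 // ltW.
set Phi := accel_potential (x, v) in F0 Phi0 *.
set N := 4^-1 ^+ epochs P in Hp *.
have N0 : 0 <= N by rewrite exprn_ge0 // invr_ge0.
(* As [t <= 1], the prefactor is at most [6 / t], and the 24 in the condition on epochs leaves
   [6 / 24 = 1 / 4]. *)
have H1 : (1 + 2 / t) * 2 * expect (svrg_prox A P W F lam b y)
     (energy A (lam + gam) (b + gam *: y)) <= t / 4 * Phi.
  have c0 : 0 <= (1 + 2 / t) * 2 by rewrite mulr_ge0 // addr_ge0 // divr_ge0 // ltW.
  apply: le_trans (ler_wpM2l c0 (le_trans Hp (ler_wpM2l N0 F0))) _.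
  have -> : (1 + 2 / t) * 2 * (N * (lam / mu * Phi)) =
            (2 * t + 4) * (lam / mu * N) / t * Phi.
    by field; rewrite !gt_eqF.
  rewrite ler_wpM2r // ler_pdivrMr //.
  have HN := P_epochs; rewrite -t2 -/N in HN.
  have lN : 0 <= lam / mu * N.
    have l0 := rayleigh_top_gt0 A0 lam1_top.
    by rewrite mulr_ge0 // divr_ge0 //; lra.
  have tlN : t * (lam / mu * N) <= lam / mu * N by exact: ler_piMl.
  by lra.
have := mulr_ge0 (sqr_ge0 t) Phi0.
by lra.
Qed.

(** The potential dominates [mu |x - xb|^2], and at the start [(0, 0)] it is at most
    [2 <xb, B xb> <= 2 |b|^2 / mu]; this accounts for the factor [2 / mu^2]. *)
Lemma accel_svrg_error :
  expect (accel_svrg A P W F lam b) (fun y => dot (y - xb) (y - xb)) <=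
  2 * (1 - t / 4) ^+ accel_iters P / mu ^+ 2 * dot b b.
Proof.
have [t0 [t1 t2]] := accel_rate_bounds.
have k0 := shift_reg_gt0; have m0 := mu0.
have pB := psd_shifted lam1_top mu0.
rewrite /accel_svrg expect_bind /=.
have dR : discrete (repeat (accel_iters P) (accel_step A P W F lam b) (0, 0)).
  exact/discrete_repeat/discrete_accel_step.
have q0 : 0 <= 1 - t / 4 by lra.
have H1 := expect_repeat (accel_iters P) (0, 0) q0 discrete_accel_step
  accel_step_contract.
have H2 : expect (repeat (accel_iters P) (accel_step A P W F lam b) (0, 0))
    (fun xv => dot (xv.1 - xb) (xv.1 - xb)) <=
  mu^-1 * expect (repeat (accel_iters P) (accel_step A P W F lam b) (0, 0))
            accel_potential.
  rewrite -expectZ; apply: le_expect => // xv.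
  rewrite mulrC ler_pdivlMr // mulrC /accel_potential.
  have := shifted_ge lam1_top lam (xv.1 - xb).
  have := mulr_ge0 (ltW mu0) (dotxx_ge0 (xv.2 - xb)).
  by lra.
apply: le_trans H2 _.
have im0 : 0 <= mu^-1 by rewrite invr_ge0 ltW.
apply: le_trans (ler_wpM2l im0 H1) _.
have H3 : accel_potential (0, 0) <= 2 * (dot b b / mu).
  rewrite /accel_potential /= sub0r formNl formNr dotNl dotNr !opprK.
  have G1 := shifted_ge lam1_top lam xb.
  have G2 : form B xb xb = dot xb b by rewrite /form sol_B.
  have G3 := dot_CS xb b.
  suff : form B xb xb <= dot b b / mu by lra.
  move: (pB.2 xb) G1 G3; rewrite -G2; set f := form B xb xb => f0 G1 G3.
  have [->|nf] := eqVneq f 0; first by rewrite divr_ge0 ?dotxx_ge0 // ltW.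
  have fp : 0 < f by rewrite lt_neqAle eq_sym nf.
  rewrite ler_pdivlMr // -(ler_pM2l fp) mulrA -expr2.
  apply: le_trans (ler_wpM2r (ltW m0) G3) _.
  rewrite mulrC mulrA ler_wpM2r ?dotxx_ge0 //.
set K := (1 - t / 4) ^+ _ in H1 *.
have K0 : 0 <= K by rewrite exprn_ge0.
have := ler_wpM2l im0 (ler_wpM2l K0 H3).
move/le_trans; apply; rewrite le_eqVlt; apply/orP; left; apply/eqP.
by field; rewrite gt_eqF.
Qed.

Lemma discrete_accel_svrg : discrete (accel_svrg A P W F lam b).
Proof.
by apply: discrete_bind => [|//]; exact/discrete_repeat/discrete_accel_step.
Qed.

End Accel.

(** * Gaussian initialization *)

Section LowerIntegral.
Local Open Scope ereal_scope.

(* The integral of a nonnegative function is a lower integral, hence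
   monotone without measurability. *)
Lemma ge0_le_integral_nonmeas d (T : measurableType d) (R : realType)
    (mu : {measure set T -> \bar R}) (f g : T -> \bar R) :
  (forall x, 0 <= f x) -> (forall x, f x <= g x) ->
  \int[mu]_x f x <= \int[mu]_x g x.
Proof.
move=> f0 fg; have g0 x : 0 <= g x by exact: le_trans (f0 x) (fg x).
rewrite !ge0_integralTE //; apply: le_ereal_sup => _ [h /= hf <-].
by exists h => //= x; exact: le_trans (hf x) (fg x).
Qed.

(** [f] will be a success probability, whose measurability is not established. It is minorized by
    [max (0, p - g)], which is measurable and, being nonnegative, can be compared with [f] under the
    lower integral. *)
Lemma integral_ge_sub d (T : measurableType d) (R : realType)
    (P : probability T R) (f : T -> \bar R) (g : T -> R) (p c : R) :
  (0 <= p)%R -> (forall x, 0 <= f x) -> (forall x, (p - g x)%:E <= f x) ->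
  (forall x, 0 <= g x)%R -> measurable_fun setT g ->
  \int[P]_x (g x)%:E <= c%:E -> (p - c)%:E <= \int[P]_x f x.
Proof.
move=> p0 f0 pgf g0 mg gc.
pose k x := Num.max 0%R (p - g x)%R.
have k0 x : (0 <= k x)%R by rewrite le_max lexx.
have mk : measurable_fun setT k.
  apply: measurable_maxr => //; exact: measurable_funB.
have kf : \int[P]_x (k x)%:E <= \int[P]_x f x.
  apply: ge0_le_integral_nonmeas => x; first by rewrite lee_fin.
  by rewrite /k EFin_max ge_max f0 pgf.
apply: le_trans kf; rewrite EFinB leeBlDr //.
have -> : p%:E = \int[P]_x (cst p%:E) x.
  by rewrite integral_cst //= probability_setT mule1.
apply: (@le_trans _ _ (\int[P]_x ((k x)%:E + (g x)%:E))).
  apply: ge0_le_integral => //=.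
  - by apply: emeasurable_funD; apply/measurable_EFinP.
  - by move=> x _; rewrite -EFinD lee_fin -lerBlDr /k le_max lexx orbT.
rewrite ge0_integralD //=; first exact: leeD2l.
- by move=> x _; rewrite lee_fin.
- exact/measurable_EFinP.
- by move=> x _; rewrite lee_fin.
- exact/measurable_EFinP.
Qed.

End LowerIntegral.

(** * Exponential moments of the normal law and the random start *)

Section Gaussian.
Variable R : realType.

Local Notation gamma := (@normal_prob R 0 1).

(** The Radon-Nikodym derivative and the normal density have the same integral on every measurable
    set, hence agree almost everywhere. *)
Lemma integral_normal_prob (g : R -> R) :
  (forall x, 0 <= g x) -> measurable_fun setT g ->
  (\int[gamma]_x (g x)%:E =
   \int[lebesgue_measure]_x (g x * normal_pdf 0 1 x)%:E)%E.
Proof.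
move=> g0 mg.
have dom := @normal_prob_dominates R 0 1.
rewrite -(Radon_Nikodym_SigmaFinite.change_of_variables dom) //=; last first.
  exact/measurable_EFinP.
have fi := Radon_Nikodym_SigmaFinite.f_integrable dom.
apply: ae_eq_integral => //.
- apply: emeasurable_funM; first exact/measurable_EFinP.
  exact: measurable_int fi.
- by apply/measurable_EFinP; apply: measurable_funM => //; exact: measurable_normal_pdf.
- have mpdf : measurable_fun [set: R] (fun x => (normal_pdf 0 1 x)%:E : \bar R).
    by apply/measurable_EFinP; exact: measurable_normal_pdf.
  have pdfE : ae_eq lebesgue_measure [set: R]%classic _ _ :=
    integral_ae_eq measurableT fi mpdf _.
  apply: filterS (pdfE _) => [x /= Hx _|E _ mE]; first by rewrite Hx // EFinM.
  by rewrite -Radon_Nikodym_SigmaFinite.f_integral.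
Qed.

(** As a function of the coordinate being drawn, each of the two potentials used below is a constant
    times such an exponential; [gquad_mean] is its standard normal mean when [-1 < a]. *)
Definition gquad (a b r : R) := expR (- (a / 2 * r ^+ 2 + b * r)).
Definition gquad_mean (a b : R) :=
  (Num.sqrt (1 + a))^-1 * expR (b ^+ 2 / (2 * (1 + a))).

Lemma measurable_gquad a b : measurable_fun setT (gquad a b).
Proof.
apply: measurableT_comp => //; apply: measurableT_comp => //.
by apply: measurable_funD; apply: measurable_funM => //; exact: measurable_funX.
Qed.

Lemma integral_gquad a b : -1 < a ->
  (\int[gamma]_r (gquad a b r)%:E = (gquad_mean a b)%:E)%E.
Proof.
move=> a1; rewrite integral_normal_prob; first last.
- exact: measurable_gquad.
- by move=> x; exact: expR_ge0.
have a0 : 0 < 1 + a by lra.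
set s := (Num.sqrt (1 + a))^-1.
have sq : 0 < Num.sqrt (1 + a) by rewrite sqrtr_gt0.
have s0 : s != 0 by rewrite invr_eq0 gt_eqF.
have s2 : s ^+ 2 = (1 + a)^-1 by rewrite exprVn sqr_sqrtr // ltW.
pose m := - b / (1 + a).
(* Completing the square: the product is a multiple of the density of mean [- b / (1 + a)] and
   variance [1 / (1 + a)]. *)
have E x : gquad a b x * normal_pdf 0 1 x = gquad_mean a b * normal_pdf m s x.
  rewrite !normal_pdfE ?oner_eq0 // /normal_peak /normal_fun /gquad_mean -/s.
  have -> : Num.sqrt (s ^+ 2 * pi *+ 2) = s * Num.sqrt (1 ^+ 2 * pi *+ 2).
    rewrite expr1n mul1r -mulrnAr sqrtrM ?sqr_ge0 // sqrtr_sqr ger0_norm //.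
    by rewrite invr_ge0 ltW.
  rewrite [(s * _)^-1]invfM s2; set z := (Num.sqrt (1 ^+ 2 * pi *+ 2))^-1.
  transitivity (z * expR (- (x ^+ 2 / 2 + a / 2 * x ^+ 2 + b * x))).
    rewrite /gquad mulrCA -expRD; congr (_ * expR _); rewrite subr0 expr1n.
    by field.
  transitivity ((s * s^-1) * z * (expR (b ^+ 2 / (2 * (1 + a))) *
     expR (- (x - m) ^+ 2 / ((1 + a)^-1 *+ 2)))); last by ring.
  rewrite mulfV // mul1r -expRD; congr (_ * expR _).
  by rewrite /m; field; rewrite gt_eqF.
under eq_integral do rewrite E EFinM.
rewrite ge0_integralZl //.
- by rewrite integral_normal_pdf mule1.
- by apply/measurable_EFinP; exact: measurable_normal_pdf.
- by move=> x _; rewrite lee_fin normal_pdf_ge0.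
- by rewrite lee_fin mulr_ge0 ?expR_ge0 // invr_ge0 sqrtr_ge0.
Qed.

Lemma gauss_step (f : R -> \bar R) p K1 a1 b1 K2 a2 b2 :
  0 <= p -> 0 <= K1 -> 0 <= K2 -> -1 < a1 -> -1 < a2 ->
  (forall r, 0 <= f r)%E ->
  (forall r, (p - (K1 * gquad a1 b1 r + K2 * gquad a2 b2 r))%:E <= f r)%E ->
  ((p - (K1 * gquad_mean a1 b1 + K2 * gquad_mean a2 b2))%:E
    <= \int[gamma]_r f r)%E.
Proof.
move=> p0 K10 K20 a10 a20 f0 H.
have q0 a b x : 0 <= gquad a b x by exact: expR_ge0.
pose gam : probability _ R := @normal_prob R 0 1.
apply: (@integral_ge_sub _ _ R gam _ _ p _ p0 f0 H) => [x||].
- by rewrite addr_ge0 // mulr_ge0.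
- by apply: measurable_funD; apply: measurable_funM => //; exact: measurable_gquad.
under eq_integral do rewrite EFinD !EFinM.
have mq K a b : measurable_fun [set: R] (fun x => K%:E * (gquad a b x)%:E)%E.
  apply: measurable_funeM; apply/measurable_EFinP; exact: measurable_gquad.
have zE K a b : 0 <= K -> -1 < a ->
    (\int[gam]_r (K%:E * (gquad a b r)%:E) = (K * gquad_mean a b)%:E)%E.
  move=> K0 a0; rewrite ge0_integralZl //.
  - by rewrite integral_gquad.
  - by apply/measurable_EFinP; exact: measurable_gquad.
  - by move=> x _; rewrite lee_fin.
rewrite ge0_integralD //=.
- by rewrite !zE // -EFinD.
all: try exact: mq.
all: by move=> x _; rewrite -EFinM lee_fin mulr_ge0.
Qed.

Section Vector.
Variables (d : nat) (u : 'cV[R]_d) (delta : R) (X : Type) (f : 'cV[R]_d -> algo R X).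
Variables (Q : X -> Prop) (p : R).
Hypothesis delta0 : 0 < delta.
Hypothesis df : forall x, discrete (f x).
Hypothesis p01 : 0 <= p <= 1.
Hypothesis good : forall x, delta ^+ 2 <= dot u x ^+ 2 -> dot x x <= 4 * d%:R ->
  (p%:E <= prob (f x) Q)%E.

Local Notation draw t w :=
  (bind (loop t (fun j v => r <- Gauss (@Ret R R);; Ret R (setv v j r)) w) f).

Let var (s : seq 'I_d) := delta ^+ 2 + \sum_(j <- s) u j 0 ^+ 2.
Let part (s : seq 'I_d) (v : 'cV[R]_d) := \sum_(j | j \notin s) u j 0 * v j 0.
Let sq (s : seq 'I_d) (v : 'cV[R]_d) := \sum_(j | j \notin s) v j 0 ^+ 2.

(* [pot1 s v] and [pot2 s v] are the means of
   [exp (1/2 - <u, x>^2 / (2 delta^2))] and of [exp (|x|^2 / 4 - d)] when the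
   coordinates in [s] remain to be drawn; they dominate the indicators of
   [|<u, x>| < delta] and [|x|^2 > 4 d]. *)
Let pot1 s v := expR 2^-1 * (delta / Num.sqrt (var s)) *
                expR (- part s v ^+ 2 / (2 * var s)).
Let pot2 s v := expR (- d%:R) * Num.sqrt 2 ^+ size s * expR (sq s v / 4).

(** Averaging [pot1] and [pot2] over one more coordinate gives their value one draw earlier, so the
    bound at the end of the loop propagates backwards. Nonnegativity is carried along because the
    lower integral requires it. *)
Lemma gauss_loop_ge s v : uniq s ->
  (0 <= prob (draw s v) Q)%E /\
  ((p - (pot1 s v + pot2 s v))%:E <= prob (draw s v) Q)%E.
Proof.
have /andP[p0 p1] := p01.
elim: s v => [|j s IH] v.
  move=> _ /=; have P0 : (0 <= prob (f v) Q)%E by exact: prob_ge0.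
  split=> //.
  have v0 : var [::] = delta ^+ 2 by rewrite /var big_nil addr0.
  have P1 : pot1 [::] v = expR (2^-1 - dot u v ^+ 2 / (2 * delta ^+ 2)).
    rewrite /pot1 v0 sqrtr_sqr gtr0_norm // divff ?gt_eqF // mulr1 -expRD.
    by rewrite mulNr.
  have P2 : pot2 [::] v = expR (- d%:R + dot v v / 4).
    by rewrite /pot2 /= expr0 mulr1 -expRD.
  have pot1_0 : 0 <= pot1 [::] v by rewrite P1 expR_ge0.
  have pot2_0 : 0 <= pot2 [::] v by rewrite P2 expR_ge0.
  (* If a requirement of [good] fails, the corresponding potential is at least 1 and the lower bound
     is at most 0. *)
  have [g1|b1] := leP (delta ^+ 2) (dot u v ^+ 2); last first.
    apply: le_trans P0; rewrite lee_fin subr_le0 (le_trans p1) //.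
    rewrite -[leLHS]addr0 lerD // P1 -[leLHS]expR0 ler_expR subr_ge0.
    rewrite ler_pdivrMr ?mulr_gt0 ?exprn_gt0 // mulrA mulVf // mul1r.
    exact: ltW.
  have [g2|b2] := leP (dot v v) (4 * d%:R); last first.
    apply: le_trans P0; rewrite lee_fin subr_le0 (le_trans p1) //.
    rewrite -[leLHS]add0r lerD // P2 -[leLHS]expR0 ler_expR; lra.
  apply: le_trans (good g1 g2); rewrite lee_fin gerBl.
  by rewrite addr_ge0.
move=> /= /andP[js us].
have D0 r : (0 <= prob (draw s (setv v j r)) Q)%E by exact: (IH _ us).1.
split; first by apply: integral_ge0 => r _.
have var0 : 0 < var s.
  by rewrite /var ltr_pwDl ?exprn_gt0 // sumr_ge0 // => i _; exact: sqr_ge0.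
have varE : var (j :: s) = var s + u j 0 ^+ 2.
  by rewrite /var big_cons addrCA addrC.
have notin_split (F : 'I_d -> R) :
    \sum_(i | i \notin s) F i = F j + \sum_(i | i \notin j :: s) F i.
  rewrite (bigD1 j) //=; congr (_ + _); apply: eq_bigl => i.
  by rewrite inE negb_or andbC.
have partE r : part s (setv v j r) = part (j :: s) v + u j 0 * r.
  rewrite /part notin_split mxE eqxx addrC; congr (_ + _).
  apply: eq_bigr => i; rewrite inE negb_or => /andP[ij _].
  by rewrite mxE (negbTE ij).
have sqE r : sq s (setv v j r) = sq (j :: s) v + r ^+ 2.
  rewrite /sq notin_split mxE eqxx addrC; congr (_ + _).
  apply: eq_bigr => i; rewrite inE negb_or => /andP[ij _].
  by rewrite mxE (negbTE ij).
set c := part (j :: s) v in partE.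
pose K1 := expR 2^-1 * (delta / Num.sqrt (var s)) * expR (- c ^+ 2 / (2 * var s)).
pose K2 := expR (- d%:R) * Num.sqrt 2 ^+ size s * expR (sq (j :: s) v / 4).
have K10 : 0 <= K1.
  by rewrite /K1 !mulr_ge0 ?expR_ge0 // ?invr_ge0 ?sqrtr_ge0 // ltW.
have K20 : 0 <= K2.
  by rewrite /K2 !mulr_ge0 ?expR_ge0 ?exprn_ge0 ?sqrtr_ge0.
pose a1 := u j 0 ^+ 2 / var s; pose b1 := c * u j 0 / var s.
have a10 : -1 < a1.
  by rewrite (@lt_le_trans _ _ 0) ?ltrN10 // divr_ge0 ?sqr_ge0 // ltW.
have a20 : -1 < - 2^-1 :> R by lra.
have pot1E r : pot1 s (setv v j r) = K1 * gquad a1 b1 r.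
  rewrite /pot1 partE /K1 -[RHS]mulrA; congr (_ * _).
  rewrite /gquad -expRD; congr expR; rewrite /a1 /b1.
  by field; rewrite gt_eqF.
have pot2E r : pot2 s (setv v j r) = K2 * gquad (- 2^-1) 0 r.
  rewrite /pot2 sqE /K2 -[RHS]mulrA; congr (_ * _).
  rewrite /gquad -expRD; congr expR.
  by field.
(* Variances add: [1 + a1] is [var (j :: s) / var s]. *)
have mean1 : K1 * gquad_mean a1 b1 = pot1 (j :: s) v.
  have va : 0 < var s + u j 0 ^+ 2 by rewrite ltr_pwDl ?sqr_ge0.
  have a1E : 1 + a1 = (var s + u j 0 ^+ 2) / var s.
    by rewrite /a1; field; rewrite gt_eqF.
  rewrite /K1 /gquad_mean /pot1 varE -/c a1E sqrtrM ?ltW // sqrtrV ?ltW //.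
  have sv : Num.sqrt (var s) != 0 by rewrite gt_eqF // sqrtr_gt0.
  have sv' : Num.sqrt (var s + u j 0 ^+ 2) != 0 by rewrite gt_eqF // sqrtr_gt0.
  transitivity (expR 2^-1 * (delta / Num.sqrt (var s + u j 0 ^+ 2)) *
    (expR (- c ^+ 2 / (2 * var s)) *
     expR (b1 ^+ 2 / (2 * ((var s + u j 0 ^+ 2) / var s))))).
    by field; rewrite sv sv'.
  rewrite -expRD; congr (_ * expR _); rewrite /b1.
  by field; rewrite !gt_eqF.
have mean2 : K2 * gquad_mean (- 2^-1) 0 = pot2 (j :: s) v.
  rewrite /K2 /gquad_mean /pot2 /= expr0n mul0r expR0 mulr1.
  have -> : 1 - 2^-1 = 2^-1 :> R by field.
  by rewrite sqrtrV // invrK exprS; ring.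
rewrite -mean1 -mean2; apply: gauss_step => // r.
by rewrite -pot1E -pot2E; exact: (IH _ us).2.
Qed.

(** Before any draw [pot1] is [e^(1/2) delta / sqrt (delta^2 + 1)] and [pot2] is [e^(-d) 2^(d/2)],
    with [sqrt 2 <= 1 + 1/2 <= e^(1/2)]. *)
Lemma gauss_vec_ge : dot u u = 1 ->
  ((p - (expR 2^-1 * delta + expR (- (d%:R / 2))))%:E
     <= prob (bind (gauss_vec R d) f) Q)%E.
Proof.
move=> u1; apply: le_trans (gauss_loop_ge 0 (enum_uniq 'I_d)).2.
rewrite lee_fin lerB // lerD // /pot1 /pot2.
  have -> : part (enum 'I_d) 0 = 0.
    by rewrite /part big_pred0 // => j; rewrite mem_enum.
  rewrite expr0n oppr0 mul0r expR0 mulr1 ler_pM2l ?expR_gt0 //.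
  have v1 : var (enum 'I_d) = delta ^+ 2 + 1.
    by rewrite /var big_enum /= -u1; congr (_ + _); apply: eq_bigr => j _.
  have sv : 1 <= Num.sqrt (var (enum 'I_d)).
    by rewrite -[leLHS]sqrtr1 ler_wsqrtr // v1 lerDr sqr_ge0.
  by rewrite ler_pdivrMr ?(lt_le_trans ltr01) // ler_peMr // ltW.
have -> : sq (enum 'I_d) 0 = 0.
  by rewrite /sq big_pred0 // => j; rewrite mem_enum.
rewrite mul0r expR0 mulr1 size_enum_ord.
have s2 : Num.sqrt 2 <= expR 2^-1 :> R.
  apply: le_trans (expR_ge1Dx _).
  have -> : 1 + 2^-1 = Num.sqrt ((1 + 2^-1) ^+ 2) :> R.
    by rewrite sqrtr_sqr ger0_norm //; lra.
  by rewrite ler_wsqrtr //; lra.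
have H : Num.sqrt 2 ^+ d <= expR 2^-1 ^+ d :> R.
  by rewrite lerXn2r // ?nnegrE ?sqrtr_ge0 ?expR_ge0.
rewrite -expRM_natl in H.
apply: le_trans (ler_wpM2l (expR_ge0 _) H) _.
by rewrite -expRD ler_expR; lra.
Qed.

End Vector.
End Gaussian.

(** * Inexact power iteration *)

(** Log-convexity makes the ratios [a k / a k.+1] nonincreasing: if the last exceeds [q], all do,
    and their product telescopes. *)
Lemma logconvex_decay (R : realType) (a : nat -> R) q N : 0 < q ->
  (forall k, 0 < a k) -> (forall k, a k.+1 ^+ 2 <= a k * a k.+2) ->
  q * a N.+1 < a N -> q ^+ N.+1 * a N.+1 < a 0%N.
Proof.
move=> q0 a0 lc; elim: N => [|N IH] H; first by rewrite expr1.
have H1 : q * a N.+1 < a N.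
  rewrite -(ltr_pM2r (a0 N.+1)) -mulrA -expr2.
  apply: le_lt_trans (ler_wpM2l (ltW q0) (lc N)) _.
  by rewrite mulrCA ltr_pM2l.
apply: lt_trans (IH H1); rewrite exprSr -mulrA ltr_pM2l //.
exact: exprn_gt0.
Qed.

Section EuclideanNorm.
Variables (R : realType) (d : nat).
Implicit Types x y : 'cV[R]_d.

Lemma enorm_ge0 x : 0 <= enorm x.
Proof. exact: sqrtr_ge0. Qed.

Lemma enorm_sqr x : enorm x ^+ 2 = dot x x.
Proof. by rewrite enormE sqr_sqrtr // dotxx_ge0. Qed.

Lemma enorm_gt0 x : (0 < enorm x) = (x != 0).
Proof. by rewrite enormE sqrtr_gt0 dotxx_gt0. Qed.

Lemma enormZ a x : enorm (a *: x) = `|a| * enorm x.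
Proof.
by rewrite !enormE dotZl dotZr mulrA -expr2 sqrtrM ?sqr_ge0 // sqrtr_sqr.
Qed.

Lemma dot_le_enorm x y : dot x y <= enorm x * enorm y.
Proof.
apply: le_trans (ler_norm _) _.
rewrite -ler_sqr ?nnegrE ?mulr_ge0 ?enorm_ge0 //.
by rewrite real_normK ?num_real // exprMn !enorm_sqr dot_CS.
Qed.

Lemma enormD x y : enorm (x + y) <= enorm x + enorm y.
Proof.
rewrite -ler_sqr ?nnegrE ?addr_ge0 ?enorm_ge0 // enorm_sqr sqrrD !enorm_sqr.
rewrite !dotL (dotC y x) mulr2n; have := dot_le_enorm x y; lra.
Qed.

Lemma enormN x : enorm (- x) = enorm x.
Proof. by rewrite -scaleN1r enormZ normrN1 mul1r. Qed.

End EuclideanNorm.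

(** * Power iteration with the scaled inverse *)

Section PowerMethod.
Variables (R : realType) (d : nat) (B : 'M[R]_d) (mu : R) (u : 'cV[R]_d).
Hypothesis sB : B^T = B.
Hypothesis mu0 : 0 < mu.
Hypothesis B_ge : forall x, mu * dot x x <= form B x x.
Hypothesis u1 : dot u u = 1.
Hypothesis Bu : B *m u = mu *: u.

Local Notation D := (mu *: invmx B).

Let uB : B \in unitmx := posdef_unit sB mu0 B_ge.

Lemma scaled_inv_sym : D^T = D.
Proof. by rewrite linearZ /= trmx_inv sB. Qed.

Lemma form_scaled_inv x : form D x x = mu^-1 * form B (D *m x) (D *m x).
Proof.
rewrite /form -scalemxAl -scalemxAr mulKVmx // !(dotZl, dotZr) (dotC (invmx _ *m _)).
by field; rewrite gt_eqF.
Qed.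

Lemma psd_scaled_inv : psd D.
Proof.
split=> [|x]; first exact: scaled_inv_sym.
rewrite form_scaled_inv; apply: mulr_ge0; first by rewrite invr_ge0 ltW.
by rewrite (le_trans _ (B_ge _)) // mulr_ge0 ?dotxx_ge0 // ltW.
Qed.

(** [mu |D x|^2 <= <D x, B D x> = mu <x, D x>], followed by Cauchy-Schwarz. *)
Lemma scaled_inv_contract x : enorm (D *m x) <= enorm x.
Proof.
have H1 := B_ge (D *m x); have H2 := form_scaled_inv x.
have H3 : dot (D *m x) (D *m x) <= enorm x * enorm (D *m x).
  apply: le_trans (dot_le_enorm _ _); rewrite -/(form D x x) H2.
  by rewrite mulrC ler_pdivlMr // mulrC.
rewrite -enorm_sqr expr2 in H3.
have [->|nz] := eqVneq (D *m x) 0.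
  by rewrite -(scale0r 0) enormZ normr0 mul0r enorm_ge0.
by rewrite -(ler_pM2r (_ : 0 < enorm (D *m x))) // enorm_gt0.
Qed.

Lemma scaled_inv_eigen x : dot u (D *m x) = dot u x.
Proof.
have Du : D *m u = u by rewrite -scalemxAl scalemxAr -Bu mulKmx.
by rewrite -dot_mulmxl scaled_inv_sym Du.
Qed.

Variable x0 : 'cV[R]_d.
Definition exact_iter k := iter k (mulmx D) x0.
Local Notation w := exact_iter.

Lemma dot_exact_iter k : dot u (w k) = dot u x0.
Proof. by elim: k => //= k <-; exact: scaled_inv_eigen. Qed.

Lemma enorm_exact_iter_le k : enorm (w k) <= enorm x0.
Proof. by elim: k => //= k; apply: le_trans; exact: scaled_inv_contract. Qed.

Lemma exact_iter_ge k : dot u x0 ^+ 2 <= dot (w k) (w k).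
Proof. by rewrite -(dot_exact_iter k) (le_trans (dot_CS _ _)) // u1 mul1r. Qed.

Lemma dot_exact_iterD i j : dot (w i) (w j) = dot x0 (w (i + j)).
Proof.
elim: i j => // i IH j; rewrite addSnnS -IH /=.
by rewrite -[RHS]dot_mulmxl scaled_inv_sym.
Qed.

Lemma form_exact_iter k :
  form B (w k.+1) (w k.+1) = mu * dot (w k.+1) (w k).
Proof.
rewrite /form; congr (dot _ _ = _): (dotZr mu (w k.+1) (w k)).
by rewrite /= -scalemxAl -scalemxAr mulKVmx.
Qed.

Hypothesis ux0 : dot u x0 != 0.

(* The moments [<x0, D^k x0>] are log-convex, so if the last ratio were below
   [1 / q], all would be, against [<x0, D^(2T) x0> >= <u, x0>^2]. *)
Lemma exact_iter_rayleigh q T : 0 < q ->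
  dot x0 x0 <= q ^+ T.+1.*2 * dot u x0 ^+ 2 ->
  form B (w T.+1) (w T.+1) <= q * mu * dot (w T.+1) (w T.+1).
Proof.
move=> q0 Hq; pose a k := dot x0 (w k).
have pos k : 0 < dot (w k) (w k).
  by apply: lt_le_trans (exact_iter_ge k); rewrite exprn_even_gt0.
have aE k : a k.*2 = dot (w k) (w k) by rewrite dot_exact_iterD addnn.
have aO k : a k.*2.+1 = dot (w k.+1) (w k) by rewrite dot_exact_iterD addSn addnn.
have a0 k : 0 < a k.
  rewrite -(odd_double_half k); case: (odd k); rewrite ?add1n ?add0n ?aE ?aO //.
  rewrite -(pmulr_rgt0 _ mu0) -form_exact_iter; apply: lt_le_trans (B_ge _).
  by rewrite mulr_gt0.
(* Cauchy-Schwarz, for the Euclidean product when [k] is even and for the form of [D] when [k] is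
   odd. *)
have lc k : a k.+1 ^+ 2 <= a k * a k.+2.
  rewrite -(odd_double_half k); move: k./2 => j; case: (odd k).
    rewrite add1n (aE j.+1 : a j.*2.+2 = _) (aO j.+1 : a j.*2.+3 = _) aO.
    rewrite -[dot (w j.+1) (w j.+1)]/(form D (w j.+1) (w j)).
    rewrite [dot (w j.+2) _]dotC [dot (w j.+1) (w j)]dotC mulrC.
    exact: psd_CS psd_scaled_inv.
  by rewrite add0n aO (aE j.+1 : a j.*2.+2 = _) aE mulrC dot_CS.
rewrite form_exact_iter [q * mu]mulrC -mulrA ler_pM2l // leNgt; apply/negP => H.
have := @logconvex_decay R a q T.*2.+1 q0 a0 lc.
rewrite -doubleS aE aO => /(_ H); apply/negP; rewrite -leNgt.
apply: le_trans Hq _; rewrite ler_wpM2l ?exprn_ge0 ?exact_iter_ge //.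
exact: ltW.
Qed.

Variables (solve : 'cV[R]_d -> algo R 'cV[R]_d) (e fail c : R) (T : nat).
Hypothesis d_gt0 : (0 < d)%N.
Hypothesis solve_discrete : forall x, discrete (solve x).
Hypothesis e0 : 0 < e.
Hypothesis solve_error : forall x,
  expect (solve x) (fun y => dot (y - invmx B *m x) (y - invmx B *m x)) <=
  fail * (e / mu) ^+ 2 * dot x x.
Hypothesis c1 : c <= 1.
Hypothesis cx0 : c * enorm x0 <= `|dot u x0|.
Hypothesis Te : 2 * T%:R * e < c.
Hypothesis Tfail : T%:R * fail <= 1.
Hypothesis fail0 : 0 <= fail.

(** The scale [s] undoes the normalizations, so that [x] is compared with the unnormalized exact
    iterate. The Gaussian start itself is not normalized, hence the guard [0 < t]. *)
Definition tracks t x :=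
  [/\ (0 < t)%N -> dot x x = 1 &
      exists2 s, 0 < s & enorm (s *: x - w t) <= 2 * t%:R * e * enorm x0].

Lemma enorm_x0_gt0 : 0 < enorm x0.
Proof.
rewrite enorm_gt0; apply: contra_neq ux0 => ->.
by rewrite -(scale0r 0) dotZr mul0r.
Qed.

Lemma enorm_exact_iter_ge k : c * enorm x0 <= enorm (w k).
Proof.
apply: le_trans cx0 _; rewrite -ler_sqr ?nnegrE ?enorm_ge0 //.
by rewrite real_normK ?num_real // enorm_sqr exact_iter_ge.
Qed.

Lemma tracks_neq0 t x : (t <= T)%N -> tracks t x -> x != 0.
Proof.
move=> tT [_ [s s0 H]]; apply/eqP => x_0; move: H.
rewrite x_0 scaler0 sub0r enormN; apply/negP; rewrite -ltNge.
apply: lt_le_trans (enorm_exact_iter_ge t).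
rewrite ltr_pM2r ?enorm_x0_gt0 //; apply: le_lt_trans Te.
by rewrite ler_wpM2r ?(ltW e0) // ler_pM2l // ler_nat.
Qed.

(** The old error passes through the contraction [D], and the new one is at most
    [e |s x| <= 2 e |x0|], because [2 t e <= c <= 1]. The correlation of the exact iterate with [u]
    keeps [y] away from 0. *)
Lemma tracks_step t x y z : (t < T)%N -> tracks t x ->
  enorm (mu *: y - D *m x) <= e * enorm x ->
  computes (normalize y) z -> tracks t.+1 z.
Proof.
move=> tT [_ [s s0 H]] Hy cz.
have [z1 zE] := runs_computesW (runs_normalize y d_gt0) cz.
have X0 := enorm_x0_gt0.
have tT1 : 2 * t%:R * e <= 1.
  apply: le_trans c1; apply: le_trans (ltW Te).
  by rewrite ler_wpM2r ?(ltW e0) // ler_pM2l // ler_nat ltnW.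
have sx : s * enorm x <= 2 * enorm x0.
  rewrite -[s in s * _]ger0_norm ?(ltW s0) // -enormZ.
  have := enormD (s *: x - w t) (w t); rewrite subrK => H1.
  have := ler_wpM2r (ltW X0) tT1; have := enorm_exact_iter_le t; lra.
have Hw : enorm ((s * mu) *: y - w t.+1) <= 2 * t.+1%:R * e * enorm x0.
  have -> : (s * mu) *: y - w t.+1 =
      s *: (mu *: y - D *m x) + D *m (s *: x - w t).
    by rewrite mulmxBr scalerBr scalerA -scalemxAr addrA subrK.
  apply: le_trans (enormD _ _) _.
  have := le_trans (scaled_inv_contract (s *: x - w t)) H => H2.
  rewrite enormZ gtr0_norm //.
  have := ler_wpM2l (ltW s0) Hy; have := ler_wpM2l (ltW e0) sx.
  rewrite -natr1; lra.
have y0 : y != 0.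
  apply/eqP => y0; move: Hw; rewrite y0 scaler0 sub0r enormN.
  apply/negP; rewrite -ltNge; apply: lt_le_trans (enorm_exact_iter_ge t.+1).
  rewrite ltr_pM2r //; apply: le_lt_trans Te.
  by rewrite ler_wpM2r ?(ltW e0) // ler_pM2l // ler_nat.
split=> [_|]; first by rewrite -enorm_sqr z1 expr1n.
have ey : 0 < enorm y by rewrite enorm_gt0.
exists (s * mu * enorm y); first by rewrite !mulr_gt0.
by rewrite zE // -enormE scalerA mulfK // gt_eqF.
Qed.

Lemma solve_step_fail t x : (t < T)%N -> tracks t x ->
  expect (y <- solve x;; normalize y) (fun z => `[< ~ tracks t.+1 z >]%:R)
  <= fail.
Proof.
move=> tT tx; rewrite expect_bind.
have xx : 0 < dot x x by rewrite dotxx_gt0 (tracks_neq0 (ltnW tT) tx).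
(* Scaled by [K], the squared solver error is at least 1 whenever the tolerance is exceeded, so it
   dominates the failure indicator. *)
pose K := (mu / e) ^+ 2 / dot x x.
have K0 : 0 <= K by rewrite divr_ge0 ?sqr_ge0 // ltW.
apply: (@le_trans _ _ (expect (solve x)
    (fun y => K * dot (y - invmx B *m x) (y - invmx B *m x)))).
  apply: le_expect => // y.
  have [z cz] := drawless_computes (drawless_normalize y).
  rewrite -[normalize y]bind_ret (expect_computes _ _ cz) /=.
  have [/asboolP nt|_] := boolP `[< ~ tracks t.+1 z >]; last first.
    by rewrite mulr_ge0 ?dotxx_ge0.
  rewrite leNgt; apply/negP => Hy; apply: nt.
  apply: tracks_step tT tx _ cz.
  rewrite -ler_sqr ?nnegrE ?mulr_ge0 ?enorm_ge0 ?(ltW e0) //.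
  rewrite exprMn !enorm_sqr -scalemxAl -scalerBr dotZl dotZr.
  move: Hy; rewrite /K; set q := dot (y - _) _ => Hy.
  have -> : mu * (mu * q) = (mu / e) ^+ 2 / dot x x * q * (e ^+ 2 * dot x x).
    by field; rewrite !gt_eqF.
  by rewrite ger_pMl ?ltW // mulr_gt0 ?exprn_gt0.
rewrite expectZ; apply: le_trans (ler_wpM2l K0 (solve_error x)) _.
rewrite le_eqVlt; apply/orP; left; apply/eqP; rewrite /K.
by field; rewrite !gt_eqF.
Qed.

Lemma discrete_power_step x : discrete (y <- solve x;; normalize y).
Proof.
by apply: discrete_bind => // y; exact/drawless_discrete/drawless_normalize.
Qed.

Lemma power_prob (Q : 'cV[R]_d -> Prop) k t x :
  (forall z, tracks T z -> Q z) -> (t + k = T)%N -> tracks t x ->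
  ((1 - k%:R * fail)%:E <=
    prob (repeat k (fun x => y <- solve x;; normalize y) x) Q)%E.
Proof.
move=> HQ; elim: k t x => [|k IH] t x.
  rewrite addn0 => -> /HQ Qx /=; rewrite mul0r subr0.
  by case: asboolP => // _; rewrite lee_fin.
rewrite addnS -addSn => tk tx; rewrite repeatS.
have tT : (t < T)%N by rewrite -tk leq_addr.
have kf : k%:R * fail <= 1.
  by apply: le_trans Tfail; rewrite ler_wpM2r // ler_nat -tk leq_addl.
have := @prob_bind_ge R _ _ (y <- solve x;; normalize y)
  (repeat k (fun x => y <- solve x;; normalize y)) (tracks t.+1) Q
  (fun z => `[< ~ tracks t.+1 z >]%:R) (1 - k%:R * fail)
  (discrete_power_step x)
  (fun z => discrete_repeat k z discrete_power_step).
rewrite subr_ge0 => /(_ kf); rewrite gerBl mulr_ge0 // => /(_ isT).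
move=> /(_ _ _ (fun z => IH t.+1 z tk)) H; apply: le_trans (H _ _) => //.
- rewrite lee_fin -natr1 mulrDl mul1r opprD addrA lerD2l lerN2.
  exact: solve_step_fail.
- by move=> z /asboolP ->.
Qed.

Lemma tracks0 : tracks 0 x0.
Proof.
split=> //; exists 1 => //.
by rewrite scale1r subrr mulr0 !mul0r -(scale0r 0) enormZ normr0 mul0r.
Qed.

End PowerMethod.

(** * Operation count *)

Section Cost.
Variable R : realType.

Local Notation any := (fun=> True).

Lemma runs_any X (c : algo R X) N Q : runs c N Q -> runs c N any.
Proof. exact: runs_weaken. Qed.

Lemma runs_repeat S k N (f : S -> algo R S) (P : S -> Prop) x :
  (forall x, P x -> runs (f x) N P) -> P x -> runs (repeat k f x) (k * N) P.
Proof.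
move=> Hf; elim: k x => [|k IH] x Px //=.
by rewrite mulSn; apply: runs_bind (Hf _ Px) IH.
Qed.

Lemma runs_gauss_vec d : runs (gauss_vec R d) d any.
Proof.
have := @runs_loop R _ _ (fun _ (_ : 'cV[R]_d) => True) (fun=> 1%N)
  (fun j v => r <- Gauss (@Ret R R);; Ret R (setv v j r)) (enum 'I_d) 0.
rewrite big_const_seq count_predT iter_addn_0 size_enum_ord mul1n.
by apply.
Qed.

Variables (n d : nat) (A : 'M[R]_(n, d)).

Lemma size_row_support i : (size (row_support A i) <= d)%N.
Proof.
by rewrite size_filter (leq_trans (count_size _ _)) // size_enum_ord.
Qed.

(** Five dense vector operations, two passes over a row with at most [d] nonzero entries, and three
    units for the draw and the scalars. *)
Lemma runs_svrg_step W F sh eta w g x :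
  runs (svrg_step A W F sh eta w g x) (9 * d + 3) any.
Proof.
rewrite addn3 /= => i; have Hs := size_row_support i.
set s := size _ in Hs.
apply: (@runs_weaken _ _ _
  (d + (2 * s + (1 + (1 + (d + (d + (2 * s + (d + d)))))))) _ any) => //; first lia.
apply: runs_bind (runs_vsub _ _) _ => u _.
apply: runs_bind (runs_row_dot _ _ _) _ => c _.
rewrite !add1n /=.
apply: runs_bind (runs_vscale _ _) _ => su _.
apply: runs_bind (runs_vadd _ _) _ => v _.
apply: runs_bind (runs_row_subtract _ _ _ _) _ => v' _.
apply: runs_bind (runs_vscale _ _) _ => ev _.
exact: runs_any (runs_vsub _ _).
Qed.

Definition epoch_time (nz m : nat) : nat :=
  2 * d + 4 * nz + (m * (10 * d + 3) + (1 + d)).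

Lemma runs_svrg_epoch W F sh eta m h w :
  runs (svrg_epoch A W F sh eta m h w) (epoch_time (nnz A) m) any.
Proof.
apply: runs_bind (runs_grad _ _ _ _) _ => g _.
apply: (@runs_bind _ _ _ _ _ _ _ any).
  apply: runs_repeat => // xs _.
  rewrite [X in runs _ X _](_ : _ = d + (9 * d + 3 + 0))%N; last by lia.
  apply: runs_bind (runs_vadd _ _) _ => s _.
  by apply: runs_bind (runs_svrg_step _ _ _ _ _ _ _) _ => x _.
move=> xs _; apply: (@runs_bind _ _ _ _ _ 1 _ any) => // c _.
exact: runs_any (runs_vscale _ _).
Qed.

Definition accel_step_time nz (P : params R) : nat :=
  epochs P * epoch_time nz (epoch_length P) + 11 * d + 3.

Lemma runs_accel_step P W F lam b xv :
  runs (accel_step A P W F lam b xv) (accel_step_time (nnz A) P) any.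
Proof.
set N := (epochs P * epoch_time (nnz A) (epoch_length P))%N.
apply: (@runs_weaken _ _ _ (1 + (d + (d + (d + (1 + (d + (d + N)) + (d + (d + (d +
  (1 + (d + (d + (d + 0)))))))))))) _ any) => //.
  by rewrite /accel_step_time -/N; lia.
apply: (@runs_bind _ _ _ _ _ 1 _ any) => // a' _.
apply: runs_bind (runs_vscale _ _) _ => y1 _.
apply: runs_bind (runs_vscale _ _) _ => y2 _.
apply: runs_bind (runs_vadd _ _) _ => y _.
apply: (@runs_bind _ _ _ _ _ _ _ any).
  apply: (@runs_bind _ _ _ _ _ 1 _ any) => // sh _.
  apply: runs_bind (runs_vscale _ _) _ => gy _.
  apply: runs_bind (runs_vadd _ _) _ => h _.
  by apply: runs_repeat => // w _; exact: runs_svrg_epoch.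
move=> x _; apply: runs_bind (runs_vsub _ _) _ => yx _.
apply: runs_bind (runs_vscale _ _) _ => syx _.
apply: runs_bind (runs_vsub _ _) _ => z _.
apply: (@runs_bind _ _ _ _ _ 1 _ any) => // m' _.
apply: runs_bind (runs_vscale _ _) _ => v1 _.
apply: runs_bind (runs_vscale _ _) _ => v2 _.
by apply: runs_bind (runs_vadd _ _) _ => v _.
Qed.

Definition power_time nz (P : params R) : nat :=
  3 * nz + (d + power_iters P *
    (accel_iters P * accel_step_time nz P + (3 * d + 3))).

(** At least one iteration is required, since the unit norm comes from the final normalization. *)
Lemma runs_shift_invert_power lam P : (0 < d)%N -> (0 < power_iters P)%N ->
  runs (shift_invert_power A lam P) (power_time (nnz A) P) (fun x => enorm x = 1).
Proof.
move=> d0 T0; apply: runs_bind (runs_row_weights _) _ => WF _.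
apply: runs_bind (runs_gauss_vec _) _ => x0 _.
set f := fun x => _.
have Hf x : runs (f x) (accel_iters P * accel_step_time (nnz A) P + (3 * d + 3))
    (fun x => enorm x = 1).
  apply: (@runs_bind _ _ _ _ _ _ _ any).
    rewrite -[X in runs _ X _]addn0; apply: (@runs_bind _ _ _ _ _ _ _ any) => //.
    by apply: runs_repeat => // xv _; exact: runs_accel_step.
  by move=> y _; apply: runs_weaken (runs_normalize y d0) => // z [].
case: (power_iters P) T0 => // T _; rewrite repeatS mulSn.
by apply: runs_bind (Hf x0) _ => x x1; apply: runs_repeat.
Qed.

End Cost.

(** * The schedule *)

Section Schedule.
Variable R : realType.

(** Always positive, so every loop runs at least once. *)
Definition nat_above (x : R) : nat := (Num.truncn x).+1.

Lemma nat_above_ge x : x <= (nat_above x)%:R.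
Proof. exact: ltW (truncnS_gt x). Qed.

Lemma nat_above_le x : 0 <= x -> (nat_above x)%:R <= x + 1.
Proof. by move=> x0; rewrite /nat_above -natr1 lerD2r truncn_le. Qed.

Definition log_scale (d : nat) (eps : R) : R := 1 + ln (d%:R / eps).

(** [F / lam1] is the stable rank. The maximum with [eps] keeps the regularizer positive also for
    denser matrices, where correctness is still claimed. *)
Definition reg_ratio (nz d : nat) (F lam1 eps : R) : R :=
  Num.max eps (Num.sqrt (F / lam1 * d%:R / nz%:R)).

(** In units of [r = e^(-L)]: [248 L / t] steps at rate [t / 4] shrink the potential by [r^62],
    [20 L] epochs give at least [r^20], and [11 L] power iterations offset a squared correlation of
    [r^22]. *)
Definition schedule_at (nz d : nat) (F lam1 lam eps : R) : params R :=
  let L := log_scale d eps in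
  let gam := lam1 * reg_ratio nz d F lam1 eps in
  let kap := lam + gam - lam1 in
  let sig := lam + gam + 2 * F * lam1 / kap in
  let t := Num.sqrt ((lam - lam1) / kap) in
  Params (nat_above (11 * L)) (nat_above (248 * L / t)) (nat_above (20 * L))
    (nat_above (64 * sig / kap)) (8 * sig)^-1 gam (t / (1 + t)) t
    (1 + gam / (lam - lam1)).

Lemma expRN1_ge : 4^-1 <= expR (- 1) :> R.
Proof.
have -> : -1 = - 2^-1 + - 2^-1 :> R by field.
have := expR_ge1Dx (- 2^-1 : R); rewrite expRD; set z := expR _ => H.
by nra.
Qed.

Lemma expR_half_le2 : expR 2^-1 <= 2 :> R.
Proof.
have := expR_ge1Dx (- 2^-1 : R); rewrite expRN => H.
rewrite -[leLHS]invrK -[leRHS]invrK lef_pV2 ?posrE ?invr_gt0 ?expR_gt0 //.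
by lra.
Qed.

Section Scale.
Variables (d : nat) (eps : R).
Hypothesis d0 : (0 < d)%N.
Hypothesis eps01 : 0 < eps < 1.

Local Notation L := (log_scale d eps).
(** This is [eps / (e d)]; all tolerances below are powers of it, and single factors are spent on
    absorbing [d], [1 / eps], [L] or constants. *)
Local Notation r := (expR (- log_scale d eps)).

Lemma dim_ge1 : 1 <= d%:R :> R.
Proof. by rewrite ler1n. Qed.

Lemma log_scale_ge1 : 1 <= L.
Proof.
have /andP[e0 e1] := eps01; rewrite lerDl ln_ge0 //.
by rewrite ler_pdivlMr // mul1r (le_trans (ltW e1)) // dim_ge1.
Qed.

Lemma scale_small : 2 * d%:R * r <= eps.
Proof.
have /andP[e0 e1] := eps01; have d1 := dim_ge1.
have dp : 0 < d%:R :> R by rewrite ltr0n.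
have q0 : 0 < d%:R / eps by rewrite divr_gt0.
rewrite /log_scale expRN expRD lnK ?posrE //.
rewrite ler_pdivrMr ?mulr_gt0 ?invr_gt0 ?expR_gt0 //.
have -> : eps * (expR 1 * (d%:R / eps)) = expR 1 * d%:R by field; rewrite gt_eqF.
by rewrite ler_pM2r ?invr_gt0 //; apply: le_trans (expR_ge1Dx _).
Qed.

Lemma scale_gt0 : 0 < r. Proof. exact: expR_gt0. Qed.

Lemma scale_le_eps : 2 * r <= eps.
Proof.
apply: le_trans scale_small; rewrite ler_pM2r ?scale_gt0 //.
by have := dim_ge1; lra.
Qed.

Lemma scale_le_half : r <= 2^-1.
Proof. by have := scale_le_eps; have /andP[_] := eps01; lra. Qed.

Lemma scale_dim : d%:R * r <= 2^-1.
Proof. by have := scale_small; have /andP[_] := eps01; lra. Qed.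

Lemma scale_log : L * r <= 1.
Proof.
rewrite expRN ler_pdivrMr ?expR_gt0 // mul1r.
by apply: le_trans (expR_ge1Dx _); rewrite lerDr.
Qed.

Lemma scaleX k : r ^+ k = expR (- (k%:R * L)).
Proof. by rewrite -expRM_natl mulrN. Qed.

Lemma scaleX_le k : r ^+ k <= 2^-1 ^+ k.
Proof. by rewrite lerXn2r ?nnegrE ?expR_ge0 ?invr_ge0 // scale_le_half. Qed.

Lemma scale_dimX k : (d%:R * r) ^+ k <= 2^-1 ^+ k.
Proof.
by rewrite lerXn2r ?nnegrE ?mulr_ge0 ?expR_ge0 ?invr_ge0 // scale_dim.
Qed.

Lemma power_iters_scale : (nat_above (11 * L))%:R * r <= 12.
Proof.
have L1 := log_scale_ge1; have r0 := scale_gt0.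
have := @nat_above_le (11 * L) _; rewrite mulr_ge0 //; last lra.
move=> /(_ isT) H; have := ler_wpM2r (ltW r0) H.
by have := scale_log; have := scale_le_half; lra.
Qed.

End Scale.
End Schedule.

(** * Frobenius norm, spectral norm and top eigenvalue *)

Section Spectral.
Variables (R : realType) (n d : nat) (A : 'M[R]_(n, d)) (lam1 : R).

Hypothesis lam1_top : forall x, form (A^T *m A) x x <= lam1 * dot x x.

(** The squared Frobenius norm is the trace of the Gram matrix, a sum of [d] Rayleigh quotients. *)
Lemma frobenius2_le : frobenius2 A <= d%:R * lam1.
Proof.
rewrite /frobenius2 exchange_big /=.
have -> : d%:R * lam1 = \sum_(j < d) lam1.
  by rewrite sumr_const card_ord mulr_natl.
apply: ler_sum => j _; have := lam1_top (delta_mx j 0).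
rewrite form_gram -colE.
have -> : dot (delta_mx j 0) (delta_mx j 0) = 1 :> R.
  rewrite /dot (bigD1 j) //= big1 => [|i ij]; last first.
    by rewrite !mxE (negbTE ij) mul0r.
  by rewrite !mxE !eqxx mulr1 addr0.
rewrite mulr1; apply: le_trans; apply: ler_sum => i _.
by rewrite !mxE expr2.
Qed.

Variable u : 'cV[R]_d.
Hypothesis u1 : dot u u = 1.
Hypothesis Au : A^T *m A *m u = lam1 *: u.

Lemma top_dot : dot (A *m u) (A *m u) = lam1.
Proof. by rewrite -form_gram /form Au dotZr u1 mulr1. Qed.

Lemma top_le_frobenius2 : lam1 <= frobenius2 A.
Proof. by rewrite -top_dot (le_trans (frobenius2_bound A u)) // u1 mulr1. Qed.

Lemma spectral_norm_sqr : spectral_norm A ^+ 2 = lam1.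
Proof.
have l0 : 0 <= lam1 by rewrite -top_dot dotxx_ge0.
have ub x : enorm x = 1 -> enorm (A *m x) <= Num.sqrt lam1.
  move=> x1; rewrite enormE ler_wsqrtr // -form_gram.
  by rewrite (le_trans (lam1_top x)) // -enorm_sqr x1 expr1n mulr1.
have att : Num.sqrt lam1 = enorm (A *m u) by rewrite enormE top_dot.
have eu : enorm u = 1 by rewrite enormE u1 sqrtr1.
rewrite /spectral_norm; set E := [set _ | _]%classic.
have -> : sup E = Num.sqrt lam1; last by rewrite sqr_sqrtr.
apply/eqP; rewrite eq_le; apply/andP; split.
  apply: ge_sup; first by exists (Num.sqrt lam1); exists u.
  by move=> _ [x x1 ->]; exact: ub.
apply: ub_le_sup; last by exists u.
by exists (Num.sqrt lam1) => _ [x x1 ->]; exact: ub.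
Qed.

Lemma stable_rankE : stable_rank A = frobenius2 A / lam1.
Proof. by rewrite /stable_rank spectral_norm_sqr. Qed.

End Spectral.

(** * Success probability *)

(** The condition on [lam * eps] makes the [B]-energy of [z - w] at most [(101 / 100^2) mu |w|^2].
    Splitting the energy with factors [3/2] and [3], and the norm with [11/10] and [11], turns 51
    into less than [12/10 (3/2 * 51 + 1)], below 101. *)
Lemma rayleigh_perturb (R : realType) (d : nat) (B : 'M[R]_d) (mu lam eps : R)
    (w z : 'cV[R]_d) :
  psd B -> 0 < mu -> 0 < eps < 1 -> lam * eps <= 101 * mu ->
  (forall x, form B x x <= lam * dot x x) ->
  form B w w <= 51 * mu * dot w w -> enorm (z - w) <= eps / 100 * enorm w ->
  form B z z <= 101 * mu * dot z z.
Proof.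
move=> pB mu0 /andP[e0 e1] lame Blam Bw zw.
have zE : z = w + (z - w) by rewrite addrC subrK.
have wE : w = z + (w - z) by rewrite addrC subrK.
have half : 2^-1 * 2 = 1 :> R by field.
have tenth : 10^-1 * 10 = 1 :> R by field.
have h0 : 0 < 2^-1 :> R by rewrite invr_gt0.
have t0 : 0 < 10^-1 :> R by rewrite invr_gt0.
have H1 := form_sqrD w (z - w) pB h0 half; rewrite -zE in H1.
have H2 := dot_sqrD z (w - z) t0 tenth; rewrite -wE in H2.
have wzE : dot (w - z) (w - z) = dot (z - w) (z - w).
  by rewrite -(opprB z w) dotNl dotNr opprK.
rewrite wzE in H2.
have Ew : dot (z - w) (z - w) <= (eps / 100) ^+ 2 * dot w w.
  rewrite -!enorm_sqr -exprMn lerXn2r ?nnegrE ?enorm_ge0 //.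
  by rewrite mulr_ge0 ?enorm_ge0 // divr_ge0 // ltW.
have H3 := Blam (z - w).
move: (dotxx_ge0 w) (dotxx_ge0 (z - w)) H1 H2 Ew H3 Bw.
set ww := dot w w; set ee := dot (z - w) _; set zz := dot z z.
move=> w0 ee0 H1 H2 Ew H3 Bw.
have lam0 : 0 <= lam * ee by apply: le_trans H3; exact: pB.2.
have H4 : lam * ee <= 101 / 100 ^+ 2 * (mu * ww).
  have [l0|l0] := leP 0 lam; last first.
    apply: (@le_trans _ _ 0); first by rewrite mulr_le0_ge0 // ltW.
    by rewrite !mulr_ge0 // ltW.
  have G1 := ler_wpM2l l0 Ew.
  have G2 : lam * eps * (eps * ww) <= 101 * mu * (1 * ww).
    apply: ler_pM => //.
    - by rewrite mulr_ge0 // ltW.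
    - by rewrite mulr_ge0 // ltW.
    - by rewrite ler_wpM2r // ltW.
  by lra.
have H5 : ee <= (100 ^+ 2)^-1 * ww.
  have G : eps ^+ 2 * ww <= ww.
    by rewrite ler_piMl // expr_le1 // ltW.
  by lra.
have H6 : ww <= 12 / 10 * zz by lra.
have H7 := ler_wpM2l (ltW mu0) H6.
have H8 := mulr_ge0 (ltW mu0) w0.
by lra.
Qed.

Section Success.
Variables (R : realType) (n d : nat) (A : 'M[R]_(n, d)) (lam1 eps : R).
Variable u : 'cV[R]_d.
Hypothesis A0 : A != 0.
Hypothesis lam1_top : forall x, form (A^T *m A) x x <= lam1 * dot x x.
Hypothesis u1 : dot u u = 1.
Hypothesis Au : A^T *m A *m u = lam1 *: u.
Hypothesis eps01 : 0 < eps < 1.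

Local Notation lam := ((1 + eps / 100) * lam1).
Local Notation F := (frobenius2 A).
Local Notation W := (sqnorms A).
Local Notation B := (shifted A lam).
Local Notation mu := (lam - lam1).
Local Notation P := (schedule_at (nnz A) d F lam1 lam eps).
Local Notation beta := (reg_ratio (nnz A) d F lam1 eps).
Local Notation gam := (lam1 * beta).
Local Notation kap := (lam + gam - lam1).
Local Notation L := (log_scale d eps).
Local Notation r := (expR (- log_scale d eps)).

Let l0 : 0 < lam1 := rayleigh_top_gt0 A0 lam1_top.

Lemma dim_gt0 : (0 < d)%N.
Proof.
rewrite lt0n; apply: contraTneq isT => d_0; move: u1.
by move: u; rewrite d_0 => v /eqP; rewrite /dot big_ord0 eq_sym oner_eq0.
Qed.

Lemma shift_gapE : mu = eps / 100 * lam1.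
Proof. by ring. Qed.

Lemma shift_gap_gt0 : 0 < mu.
Proof.
have /andP[e0 _] := eps01; rewrite shift_gapE mulr_gt0 ?l0 //.
by rewrite divr_gt0.
Qed.

Lemma reg_ratio_ge_eps : eps <= beta.
Proof. by rewrite le_max lexx. Qed.

Lemma reg_gt0 : 0 < gam.
Proof.
have /andP[e0 _] := eps01.
by rewrite mulr_gt0 ?l0 // (lt_le_trans e0) // reg_ratio_ge_eps.
Qed.

Lemma reg_ratio_le_dim : beta <= d%:R.
Proof.
have /andP[e0 e1] := eps01; have d1 := @dim_ge1 R d dim_gt0.
rewrite ge_max (le_trans (ltW e1)) //=.
rewrite -[leRHS]ger0_norm // -sqrtr_sqr ler_wsqrtr // expr2.
have F0 := frobenius2_ge0 A.
have Fd : F / lam1 <= d%:R by rewrite ler_pdivrMr ?l0 // frobenius2_le.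
have i1 : (nnz A)%:R^-1 <= 1 :> R.
  case: (nnz A) => [|k]; first by rewrite invr0.
  by rewrite invf_le1 // ler1n.
have i0 : 0 <= (nnz A)%:R^-1 :> R by rewrite invr_ge0.
have Fl0 : 0 <= F / lam1 by rewrite divr_ge0 // ltW // l0.
rewrite -[leRHS]mulr1; apply: ler_pM => //; first by rewrite mulr_ge0.
by rewrite ler_wpM2r.
Qed.

Lemma schedule_epochs : 24 * (lam / mu) * 4^-1 ^+ epochs P <= mu / kap.
Proof.
have /andP[e0 e1] := eps01; have d1 := @dim_ge1 R d dim_gt0.
have b1 := reg_ratio_le_dim; have be := reg_ratio_ge_eps.
have m0 := shift_gap_gt0; have g0 := reg_gt0; have l_0 := l0.
have N20 : 4^-1 ^+ epochs P <= r ^+ 20.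
  apply: (@le_trans _ _ (expR (-1) ^+ epochs P)).
    by rewrite lerXn2r ?nnegrE ?expR_ge0 ?invr_ge0 ?expRN1_ge.
  rewrite -expRM_natl scaleX ler_expR mulrN1 lerN2.
  exact: nat_above_ge.
have p0 : 0 <= 4^-1 ^+ epochs P :> R by rewrite exprn_ge0 // invr_ge0.
move: (4^-1 ^+ epochs P) N20 p0 => N N20 p0.
have -> : mu / kap = eps / (eps + 100 * beta).
  move: beta be => q qe.
  have -> : lam + lam1 * q - lam1 = (eps / 100 + q) * lam1 by ring.
  rewrite shift_gapE; field.
  by rewrite !gt_eqF ?l0 //; lra.
have -> : lam / mu = (100 + eps) / eps.
  by rewrite shift_gapE; field; rewrite !gt_eqF ?l0.
rewrite ler_pdivlMr; last by lra.
have K1 : 24 * ((100 + eps) / eps) * N * (eps + 100 * beta) <=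
  24 * (101 / eps) * r ^+ 20 * (101 * d%:R).
  have q0 : 0 <= (100 + eps) / eps by rewrite divr_ge0 //; lra.
  apply: ler_pM; [|lra| |lra].
    by rewrite mulr_ge0 // mulr_ge0.
  apply: ler_pM => //; first by rewrite mulr_ge0.
  by rewrite ler_pM2l // ler_pM2r ?invr_gt0 //; lra.
apply: le_trans K1 _.
(* Of the 20 factors [r], 17 beat the constant, one cancels [d], one yields the required [eps] and
   one cancels [1 / eps]. *)
have -> : 24 * (101 / eps) * r ^+ 20 * (101 * d%:R) =
  24 * 101 * 101 * r ^+ 17 * (d%:R * r) * r * (r / eps) by field; rewrite gt_eqF.
have R17 := @scaleX_le R d eps dim_gt0 eps01 17.
have r0 := @scale_gt0 R d eps.
have rd := scale_dim dim_gt0 eps01.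
have re := scale_le_eps dim_gt0 eps01.
have reps : r / eps <= 1 by rewrite ler_pdivrMr //; lra.
have c1 : 24 * 101 * 101 * r ^+ 17 <= 2.
  by lra.
have c0 : 0 <= r ^+ 17 by rewrite exprn_ge0 // ltW.
have drp : 0 <= d%:R * r by rewrite mulr_ge0 // ltW.
have c2 : 24 * 101 * 101 * r ^+ 17 * (d%:R * r) <= 1.
  have : 24 * 101 * 101 * r ^+ 17 * (d%:R * r) <= 2 * 2^-1.
    by apply: ler_pM => //; rewrite mulr_ge0.
  by lra.
have c3 : 24 * 101 * 101 * r ^+ 17 * (d%:R * r) * r <= eps.
  have : 24 * 101 * 101 * r ^+ 17 * (d%:R * r) * r <= 1 * eps.
    by apply: ler_pM => //; lra.
  by lra.
rewrite -[leRHS]mulr1; apply: ler_pM => //.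
by rewrite divr_ge0 // ltW.
Qed.

(** Tolerance [r^25] and failure probability [r^11] need the exponent [11 + 2 * 25 = 61]; the solver
    reaches [2 r^62], and [r <= 1/2]. *)
Lemma schedule_solve_error x :
  expect (accel_svrg A P W F lam x)
    (fun y => dot (y - invmx B *m x) (y - invmx B *m x)) <=
  r ^+ 11 * (r ^+ 25 / mu) ^+ 2 * dot x x.
Proof.
have m0 := shift_gap_gt0; have g0 := reg_gt0; have l_0 := l0.
have k0 : 0 < kap by have := addr_gt0 m0 g0; lra.
have F0 := frobenius2_gt0 A0.
have s0 : 0 < lam + gam + 2 * F * lam1 / kap.
  have a0 : 0 < 2 * F * lam1 / kap by rewrite divr_gt0 // !mulr_gt0.
  by lra.
have stepE (a : R) : 0 < a -> (8 * a)^-1 * a = 8^-1.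
  by move=> a0; field; rewrite gt_eqF.
have H := @accel_svrg_error R n d A lam1 lam gam A0 lam1_top m0 g0 P erefl erefl
  erefl erefl.
apply: le_trans (H _ _ _ schedule_epochs x) _.
- exact: stepE s0.
- exact: nat_above_ge.
- by [].
clear H; rewrite ler_wpM2r ?dotxx_ge0 //.
set t := Num.sqrt (mu / kap).
have t0 : 0 < t by rewrite sqrtr_gt0 divr_gt0.
have L1 := log_scale_ge1 dim_gt0 eps01.
have r0 := @scale_gt0 R d eps.
have powE (q a : R) : 0 < a -> q ^+ 11 * (q ^+ 25 / a) ^+ 2 = q ^+ 61 / a ^+ 2.
  by move=> a0; field; rewrite gt_eqF.
rewrite powE //.
rewrite ler_pM2r ?invr_gt0 ?exprn_gt0 //.
have tl1 : t <= 1.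
  rewrite -[leRHS]sqrtr1 ler_wsqrtr // ler_pdivrMr // mul1r.
  by have := g0; lra.
have E1 : (1 - t / 4) ^+ accel_iters P <= r ^+ 62.
  apply: (@le_trans _ _ (expR (- (t / 4)) ^+ accel_iters P)).
    rewrite lerXn2r ?nnegrE ?expR_ge0 ?expR_ge1Dx //; lra.
  rewrite -expRM_natl scaleX ler_expR mulrN lerN2.
  have Ka := @nat_above_ge R (248 * L / t).
  rewrite -[nat_above _]/(accel_iters P) in Ka.
  have := ler_wpM2r (ltW (divr_gt0 t0 (ltr0n R 4))) Ka.
  have -> : 248 * L / t * (t / 4) = 62 * L by field; rewrite gt_eqF.
  by [].
move: (_ ^+ accel_iters P) E1 => K E1.
have rh := scale_le_half dim_gt0 eps01.
have E2 : r ^+ 62 <= 2^-1 * r ^+ 61.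
  by rewrite exprS ler_wpM2r // exprn_ge0 // ltW.
by lra.
Qed.

Variable x0 : 'cV[R]_d.
Hypothesis x0_corr : (d%:R ^- 10) ^+ 2 <= dot u x0 ^+ 2.
Hypothesis x0_norm : dot x0 x0 <= 4 * d%:R.

(** From [|x0| <= 2 d] and correlation at least [d^-10]: the claim reduces to [2 (d r)^11 <= 1]. *)
Lemma start_corr : r ^+ 11 * enorm x0 <= `|dot u x0|.
Proof.
have d1 := @dim_ge1 R d dim_gt0; have r0 := @scale_gt0 R d eps.
have rd := @scale_dimX R d eps dim_gt0 eps01 11.
have dX : 0 < d%:R ^+ 10 :> R by rewrite exprn_gt0 // ltr0n dim_gt0.
have H1 : d%:R ^- 10 <= `|dot u x0|.
  rewrite -ler_sqr ?nnegrE ?invr_ge0 ?(ltW dX) ?normr_ge0 //.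
  by rewrite real_normK ?num_real.
apply: le_trans H1.
have H2 : enorm x0 <= 2 * d%:R.
  rewrite -ler_sqr ?nnegrE ?enorm_ge0 ?mulr_ge0 // enorm_sqr.
  apply: le_trans x0_norm _; rewrite exprMn.
  have := ler_wpM2l (ler0n R d) d1; lra.
rewrite -(ler_pM2r dX) mulVf ?gt_eqF //.
have r11 : 0 <= r ^+ 11 by rewrite exprn_ge0 // ltW.
have := ler_wpM2r (ltW dX) (ler_wpM2l r11 H2) => H3.
apply: le_trans H3 _.
have -> : r ^+ 11 * (2 * d%:R) * d%:R ^+ 10 = 2 * (d%:R * r) ^+ 11 by ring.
have : 2^-1 ^+ 11 <= 2^-1 :> R.
  by rewrite -[leRHS]expr1 ler_wiXn2l // ?invr_ge0 // invf_le1 // ler1n.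
by lra.
Qed.

Lemma start_neq0 : dot u x0 != 0.
Proof.
have d1 := dim_gt0; apply/eqP => z; move: x0_corr.
rewrite z expr0n /= leNgt exprn_gt0 //.
by rewrite invr_gt0 exprn_gt0 // ltr0n.
Qed.

Local Notation T := (power_iters P).

Lemma shift_top : B *m u = mu *: u.
Proof. by rewrite /shifted mulmxBl mul_scalar_mx Au scalerBl. Qed.

(** Of the 25 factors [r], 11 are kept, one absorbs [T], 12 beat the constants and one supplies
    [eps]. *)
Lemma schedule_drift : 2 * T%:R * r ^+ 25 <= r ^+ 11 * (eps / 100) / 2.
Proof.
have r0 := @scale_gt0 R d eps.
have Tr := power_iters_scale dim_gt0 eps01.
have re := scale_le_eps dim_gt0 eps01.
have R12 := @scaleX_le R d eps dim_gt0 eps01 12.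
have r11 : 0 <= r ^+ 11 by rewrite exprn_ge0 // ltW.
have r12 : 0 <= r ^+ 12 by rewrite exprn_ge0 // ltW.
have -> : 2 * T%:R * r ^+ 25 = r ^+ 11 * (2 * (T%:R * r) * (r ^+ 12 * r)) by ring.
rewrite -[leRHS]mulrA ler_wpM2l //.
have A1 : r ^+ 12 * r <= 2^-1 ^+ 12 * (eps / 2).
  by apply: ler_pM => //; lra.
have A2 : T%:R * r * (r ^+ 12 * r) <= 12 * (2^-1 ^+ 12 * (eps / 2)).
  exact: ler_pM.
by have /andP[e0 _] := eps01; lra.
Qed.

Lemma schedule_failure : T%:R * r ^+ 11 <= d%:R ^- 10.
Proof.
have Tr := power_iters_scale dim_gt0 eps01; have r0 := @scale_gt0 R d eps.
have d10 : 0 < d%:R ^+ 10 :> R by rewrite exprn_gt0 // ltr0n dim_gt0.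
rewrite -[leRHS]mul1r ler_pdivlMr //.
have -> : T%:R * r ^+ 11 * d%:R ^+ 10 = T%:R * r * (d%:R * r) ^+ 10 by ring.
have := scale_dimX dim_gt0 eps01 10.
have : 0 <= (d%:R * r) ^+ 10 by rewrite exprn_ge0 // mulr_ge0 // ltW.
move: (T%:R * r) ((d%:R * r) ^+ 10) Tr => a b a12 b0 b1.
have := ler_wpM2r b0 a12; lra.
Qed.

Lemma tracks_success z : tracks B mu x0 (r ^+ 25) T z ->
  (1 - eps) * lam1 <= (z^T *m (A^T *m A) *m z) 0 0.
Proof.
have m0 := shift_gap_gt0; have /andP[e0 e1] := eps01.
have pB := psd_shifted lam1_top m0.
have T0 : (0 < T)%N by [].
move=> [/(_ T0) z1 [s s0 Hs]].
have Bu := shift_top; have r0 := @scale_gt0 R d eps.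
have cg := enorm_exact_iter_ge pB.1 m0 (shifted_ge lam1_top lam) u1 Bu
  start_corr T.
set w := exact_iter B mu x0 T in Hs cg.
have zw : enorm (s *: z - w) <= eps / 100 * enorm w.
  apply: le_trans Hs _.
  apply: (@le_trans _ _ (r ^+ 11 * (eps / 100) / 2 * enorm x0)).
    by rewrite ler_wpM2r ?enorm_ge0 // schedule_drift.
  have e100 : 0 <= eps / 100 by rewrite divr_ge0 // ltW.
  have := ler_wpM2l e100 cg; have := mulr_ge0 e100 (enorm_ge0 w); lra.
have Hray : form B w w <= 51 * mu * dot w w.
  have := @exact_iter_rayleigh R d B mu u pB.1 m0 (shifted_ge lam1_top lam) u1 Bu
    x0 start_neq0 51 T.-1 (ltr0n R 51).
  rewrite prednK // -/w; apply.
  have corr := start_corr.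
  have c2 : (r ^+ 11 * enorm x0) ^+ 2 <= dot u x0 ^+ 2.
    rewrite -[leRHS]real_normK ?num_real // lerXn2r ?nnegrE ?normr_ge0 //.
    by rewrite mulr_ge0 ?enorm_ge0 // exprn_ge0 // ltW.
  rewrite exprMn enorm_sqr in c2.
  have q0 : 0 <= 51 ^+ T.*2 :> R by rewrite exprn_ge0.
  have := ler_wpM2l q0 c2; apply: le_trans.
  rewrite mulrA ler_peMl ?dotxx_ge0 //.
  (* Through [e <= 4 <= 51], the power [51^(2T)] exceeds [e^(22 L)], which cancels the squared
     correlation [r^22]. *)
  have H51 : expR 1 ^+ T.*2 <= 51 ^+ T.*2 :> R.
    rewrite lerXn2r ?nnegrE ?expR_ge0 //.
    have := @expRN1_ge R; rewrite expRN lef_pV2 ?posrE ?expR_gt0 //.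
    by move=> H; apply: le_trans H _; rewrite ler_nat.
  have HT : expR (22 * L) <= expR 1 ^+ T.*2.
    rewrite -expRM_natl mulr1 ler_expR -muln2 natrM.
    have -> : 22 * L = 11 * L * 2 by ring.
    by rewrite ler_pM2r // nat_above_ge.
  have := ler_wpM2r (exprn_ge0 2 (exprn_ge0 11 (ltW r0))) (le_trans HT H51).
  apply: le_trans; rewrite -exprM scaleX -expRD -[leLHS]expR0 ler_expR.
  by rewrite le_eqVlt; apply/orP; left; apply/eqP; ring.
have lame : lam * eps <= 101 * mu.
  rewrite shift_gapE; have := mulr_gt0 e0 l0.
  have : eps * (eps * lam1) <= eps * lam1.
    by rewrite ler_piMl ?mulr_ge0 ?(ltW e0) ?(ltW e1) ?(ltW l0).
  by lra.
have H := rayleigh_perturb pB m0 eps01 lame (shifted_le A lam) Hray zw.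
rewrite formZl formZr dotZl dotZr z1 mulr1 in H.
have s2 : 0 < s * s by rewrite mulr_gt0.
(* As [101 mu = 1.01 eps lam1], subtracting from [lam] leaves exactly [(1 - eps) lam1]. *)
have H2 : form B z z <= 101 * mu.
  by rewrite -(ler_pM2l s2); move: H; lra.
rewrite -mulmxA -dotE -/(form (A^T *m A) z z).
move: H2; rewrite /shifted formB form_scalar z1 mulr1 shift_gapE.
by lra.
Qed.

Lemma power_success :
  ((1 - T%:R * r ^+ 11)%:E <=
    prob (repeat T (fun x => y <- accel_svrg A P W F lam x;; normalize y) x0)
      (fun x => (1 - eps) * lam1 <= (x^T *m (A^T *m A) *m x) 0 0)%R)%E.
Proof.
have m0 := shift_gap_gt0; have r0 := @scale_gt0 R d eps.
have pB := psd_shifted lam1_top m0.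
have rh := scale_le_half dim_gt0 eps01.
have /andP[e0 e1] := eps01.
have r11 : 0 < r ^+ 11 by rewrite exprn_gt0.
have c1 : r ^+ 11 <= 1 by rewrite exprn_ile1 ?ltW //; lra.
have Te : 2 * T%:R * r ^+ 25 < r ^+ 11.
  apply: le_lt_trans schedule_drift _.
  by rewrite -mulrA gtr_pMr //; lra.
have Tf : T%:R * r ^+ 11 <= 1.
  apply: le_trans schedule_failure _.
  by rewrite invf_le1 ?exprn_gt0 ?ltr0n ?dim_gt0 // exprn_ege1 // dim_ge1 ?dim_gt0.
apply: (power_prob pB.1 m0 (shifted_ge lam1_top lam) u1 shift_top start_neq0
  dim_gt0 (discrete_accel_svrg lam A0 P) (exprn_gt0 25 r0)
  schedule_solve_error c1 start_corr Te Tf (ltW r11) tracks_success (add0n _)).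
exact: tracks0.
Qed.

End Success.

(** [e^(d/2)] is the tenth power of [e^(d/20) >= d / 20]. *)
Lemma expR_half_dim (R : realType) (d : nat) : (0 < d)%N ->
  expR (- (d%:R / 2)) <= 20 ^+ 10 / d%:R ^+ 10 :> R.
Proof.
move=> d0; have dR : 0 < d%:R :> R by rewrite ltr0n.
have -> : 20 ^+ 10 / d%:R ^+ 10 = ((d%:R / 20) ^+ 10)^-1 :> R.
  by rewrite -invf_div expr_div_n.
rewrite expRN lef_pV2 ?posrE ?expR_gt0 ?exprn_gt0 ?divr_gt0 //.
have -> : d%:R / 2 = 10%:R * (d%:R / 20) :> R by field.
rewrite expRM_natl lerXn2r ?nnegrE ?expR_ge0 ?divr_ge0 //.
by apply: le_trans (expR_ge1Dx _); rewrite lerDr.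
Qed.

Lemma shift_invert_power_success (R : realType) (n d : nat) (A : 'M[R]_(n, d))
    (lam1 eps : R) (u : 'cV[R]_d) (lam := (1 + eps / 100) * lam1) :
  A != 0 -> (forall x, form (A^T *m A) x x <= lam1 * dot x x) ->
  dot u u = 1 -> A^T *m A *m u = lam1 *: u -> 0 < eps < 1 ->
  ((1 - 20 ^+ 11 / d%:R ^+ 10)%:E <=
    prob (shift_invert_power A lam
           (schedule_at (nnz A) d (frobenius2 A) lam1 lam eps))
      (fun x => (1 - eps) * lam1 <= (x^T *m (A^T *m A) *m x) 0 0)%R)%E.
Proof.
move=> A0 top u1 Au eps01.
have d0 := dim_gt0 u1; have dR : 0 < d%:R :> R by rewrite ltr0n.
have i10 : 0 < d%:R ^- 10 :> R by rewrite invr_gt0 exprn_gt0.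
have i1 : d%:R ^- 10 <= 1 :> R.
  by rewrite invf_le1 ?exprn_gt0 // exprn_ege1 // ler1n.
have Tf := schedule_failure A lam1 u1 eps01.
set P := schedule_at _ _ _ _ _ _ in Tf *.
pose f x0 := repeat (power_iters P)
  (fun x => y <- accel_svrg A P (sqnorms A) (frobenius2 A) lam x;; normalize y) x0.
rewrite /shift_invert_power (prob_computes _ _ (computes_row_weights A)).
have df x : discrete (f x).
  apply: discrete_repeat => z; apply: discrete_power_step => y.
  exact: discrete_accel_svrg.
have p01 : 0 <= 1 - (power_iters P)%:R * expR (- log_scale d eps) ^+ 11 <= 1.
  by rewrite subr_ge0 gerBl (le_trans Tf i1) mulr_ge0 ?exprn_ge0 ?expR_ge0.
(* With [delta = d^-10] the failures total at most [(1 + 2 + 20^10) d^-10]: the solver, a small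
   correlation and a large norm. *)
apply: le_trans (gauss_vec_ge i10 df p01 _ u1); last first.
  by move=> x cx nx; exact: power_success A0 top u1 Au eps01 _ cx nx.
rewrite lee_fin.
have H1 := ler_wpM2r (ltW i10) (expR_half_le2 R).
have H2 := expR_half_dim R d0.
move: ((power_iters P)%:R * _) Tf => a Tf.
move: (expR 2^-1 * _) (expR (- (d%:R / 2))) H1 H2 => b c H1 H2.
by lra.
Qed.

(** * Total time *)

(** An epoch costs [O(nz)] since its length times [d] does; the three enclosing loops multiply this
    by [L], [L S] and [L], and lower-order terms are absorbed using [1 <= d <= nz]. *)
Lemma power_time_le (R : realType) (d nz : nat) (P : params R) (L S : R) :
  (0 < d <= nz)%N -> 1 <= L -> 1 <= S ->
  (power_iters P)%:R <= 12 * L -> (accel_iters P)%:R <= 2729 * L * S ->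
  (epochs P)%:R <= 21 * L -> (epoch_length P)%:R * d%:R <= 321 * nz%:R :> R ->
  (power_time d nz P)%:R <= 4 * 10 ^+ 9 * (nz%:R * S * L ^+ 3).
Proof.
move=> /andP[d0 dn] L1 S1 HT HK HE Hm.
rewrite /power_time /accel_step_time /epoch_time !(natrD, natrM).
have y1 : 1 <= d%:R :> R by rewrite ler1n.
have yx : d%:R <= nz%:R :> R by rewrite ler_nat.
have T0 := ler0n R (power_iters P); have K0 := ler0n R (accel_iters P).
have E0 := ler0n R (epochs P); have m0 := ler0n R (epoch_length P).
move: (power_iters P)%:R (accel_iters P)%:R (epochs P)%:R (epoch_length P)%:R
  d%:R nz%:R HT HK HE Hm y1 yx T0 K0 E0 m0 => T K E m y x.
move=> HT HK HE Hm y1 yx T0 K0 E0 m0.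
have x0 : 1 <= x by exact: le_trans yx.
have xp : 0 <= x by lra.
have [L0 S0] : 0 <= L /\ 0 <= S by split; lra.
pose ep := 2 * y + 4 * x + (m * (10 * y + 3) + (1 + y)).
have ep1 : ep <= 4200 * x.
  have G : m <= m * y by rewrite ler_peMr.
  by rewrite /ep; lra.
have ep0 : 0 <= ep.
  have G : 0 <= m * y by rewrite mulr_ge0 //; lra.
  by rewrite /ep; lra.
have Lx : x <= L * x by rewrite ler_peMl.
have H1 : E * ep + 11 * y + 3 <= 10 ^+ 5 * (L * x).
  have := ler_pM E0 ep0 HE ep1; lra.
have H10 : 0 <= E * ep + 11 * y + 3.
  by have := mulr_ge0 E0 ep0; lra.
have LSx : x <= L ^+ 2 * S * x.
  by rewrite ler_peMl // mulr_ege1 // exprn_ege1.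
have H2 : K * (E * ep + 11 * y + 3) + (3 * y + 3) <= 3 * 10 ^+ 8 * (L ^+ 2 * S * x).
  have := ler_pM K0 H10 HK H1; lra.
have H20 : 0 <= K * (E * ep + 11 * y + 3) + (3 * y + 3).
  by have := mulr_ge0 K0 H10; lra.
have LSx3 : x <= L ^+ 3 * S * x.
  by rewrite ler_peMl // mulr_ege1 // exprn_ege1.
apply: (@le_trans _ _ (3 * x + (y + T * (K * (E * ep + 11 * y + 3) + (3 * y + 3))))).
  by rewrite /ep; lra.
have H3 := ler_pM T0 H20 HT H2.
move: (T * (_ + _)) H3 => V H3.
clear - yx xp H3 LSx3.
have H3' : V <= 36 * 10 ^+ 8 * (L ^+ 3 * S * x) by lra.
have -> : x * S * L ^+ 3 = L ^+ 3 * S * x by ring.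
move: (L ^+ 3 * S * x) LSx3 H3' => q LSx3 H3'.
by lra.
Qed.

Section TimeBound.
Variables (R : realType) (d nz : nat) (F lam1 eps : R).
Hypothesis dn : (1 < d <= nz)%N.
Hypothesis lam1_gt0 : 0 < lam1.
Hypothesis sr1 : 1 <= F / lam1.
Hypothesis eps01 : 0 < eps < 1.
Hypothesis nz_le : nz%:R <= d%:R * (F / lam1) / eps ^+ 2.

Local Notation lam := ((1 + eps / 100) * lam1).
Local Notation sr := (F / lam1).
Local Notation beta := (reg_ratio nz d F lam1 eps).
Local Notation L := (log_scale d eps).
Local Notation P := (schedule_at nz d F lam1 lam eps).

Let d_gt0 : (0 < d)%N. Proof. by case/andP: dn => /ltnW. Qed.
Let dR : 0 < d%:R :> R. Proof. by rewrite ltr0n. Qed.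
Let nzR : 0 < nz%:R :> R.
Proof. by rewrite ltr0n (leq_trans d_gt0) //; case/andP: dn. Qed.

Lemma reg_ratioE : beta = Num.sqrt (sr * d%:R / nz%:R).
Proof.
have /andP[e0 e1] := eps01; rewrite /reg_ratio; apply/max_idPr.
rewrite -[leLHS]ger0_norm ?(ltW e0) // -sqrtr_sqr ler_wsqrtr //.
by rewrite ler_pdivlMr // mulrC -ler_pdivlMr ?exprn_gt0 // [sr * _]mulrC.
Qed.

Lemma reg_ratio_gt0 : 0 < beta.
Proof.
have /andP[e0 _] := eps01; by rewrite (lt_le_trans e0) // le_max lexx.
Qed.

Lemma reg_ratio_sqr : beta ^+ 2 = sr * d%:R / nz%:R.
Proof.
rewrite reg_ratioE sqr_sqrtr // divr_ge0 ?(ltW nzR) // mulr_ge0 //.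
by apply: le_trans sr1.
Qed.

(** With [k = beta + eps / 100] the length is about [64 (1 + 1/k + 2 sr / k^2)]. Since
    [sr / beta^2 = nz / d >= 1] and [2 / k <= 1 + 1 / k^2], it is [O(nz / d)]. *)
Lemma schedule_epoch_length : (epoch_length P)%:R * d%:R <= 321 * nz%:R :> R.
Proof.
have /andP[e0 e1] := eps01.
have b0 := reg_ratio_gt0; have b2 := reg_ratio_sqr.
have dz : d%:R <= nz%:R :> R by rewrite ler_nat; case/andP: dn.
have key : 64 * (lam + lam1 * beta + 2 * F * lam1 / (lam + lam1 * beta - lam1))
   / (lam + lam1 * beta - lam1) <= 320 * (nz%:R / d%:R).
  move: beta b0 b2 => b b0 b2.
  have -> : lam + lam1 * b - lam1 = lam1 * (b + eps / 100) by ring.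
  have -> : lam + lam1 * b = lam1 * (b + eps / 100) + lam1 by ring.
  set k := b + eps / 100; have bk : b <= k by rewrite /k; lra.
  have k0 : 0 < k by exact: lt_le_trans bk.
  have -> : 64 * (lam1 * k + lam1 + 2 * F * lam1 / (lam1 * k)) / (lam1 * k) =
    64 * (1 + k^-1 + 2 * (sr * k^-1 ^+ 2)).
    by field; rewrite !gt_eqF.
  have ib : k^-1 <= b^-1 by rewrite lef_pV2 ?posrE.
  have ik0 : 0 <= k^-1 by rewrite invr_ge0 ltW.
  have ik2 : k^-1 ^+ 2 <= b^-1 ^+ 2 by rewrite lerXn2r ?nnegrE // invr_ge0 ltW.
  have sr0 : 0 < sr by exact: lt_le_trans sr1.
  have srb : sr * b^-1 ^+ 2 = nz%:R / d%:R.
    rewrite exprVn b2; move: sr sr0 => q q0.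
    by field; rewrite !gt_eqF.
  have q1 : 1 <= nz%:R / d%:R :> R by rewrite ler_pdivlMr ?mul1r.
  have s1 : k^-1 ^+ 2 <= sr * k^-1 ^+ 2 by rewrite ler_peMl // sqr_ge0.
  have s2 : sr * k^-1 ^+ 2 <= nz%:R / d%:R by rewrite -srb ler_pM2l.
  have := sqr_ge0 (k^-1 - 1).
  move: (sr * k^-1 ^+ 2) s1 s2 => q s1 s2.
  move: (nz%:R / d%:R) q1 s2 => p q1 s2 sq.
  have sq' : 0 <= k^-1 ^+ 2 - 2 * k^-1 + 1 by lra.
  lra.
have key0 : 0 <= 64 * (lam + lam1 * beta + 2 * F * lam1 / (lam + lam1 * beta - lam1))
   / (lam + lam1 * beta - lam1).
  have F0 : 0 <= F.
    by have := sr1; rewrite ler_pdivlMr // mul1r; apply: le_trans; exact: ltW.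
  have k0 : 0 < lam + lam1 * beta - lam1.
    have -> : lam + lam1 * beta - lam1 = lam1 * (beta + eps / 100) by ring.
    by rewrite mulr_gt0 // addr_gt0 // divr_gt0.
  have l0 : 0 <= lam by rewrite mulr_ge0 ?ltW // addr_gt0 // divr_gt0.
  rewrite divr_ge0 ?(ltW k0) // mulr_ge0 // addr_ge0 //.
    by rewrite addr_ge0 // mulr_ge0 // ltW.
  by rewrite divr_ge0 ?(ltW k0) // mulr_ge0 ?(ltW lam1_gt0) // mulr_ge0.
have H := le_trans (nat_above_le key0) (lerD key (lexx 1)).
rewrite -[nat_above _]/(epoch_length P) in H.
have := ler_wpM2r (ltW dR) H.
have -> : (320 * (nz%:R / d%:R) + 1) * d%:R = 320 * nz%:R + d%:R :> R.
  by field; rewrite gt_eqF.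
move/le_trans; apply; lra.
Qed.

(** [1 / t^2 = (100 beta + eps) / eps <= 11^2 beta / eps], and [2729 = 248 * 11 + 1] allows for
    rounding. *)
Lemma schedule_accel_iters :
  (accel_iters P)%:R <= 2729 * L * Num.sqrt (beta / eps).
Proof.
have /andP[e0 e1] := eps01; have b0 := reg_ratio_gt0.
have be : eps <= beta by rewrite le_max lexx.
have L1 := log_scale_ge1 d_gt0 eps01.
rewrite /=; move: beta b0 be => b b0 be.
have -> : lam - lam1 = eps / 100 * lam1 by ring.
have -> : lam + lam1 * b - lam1 = (b + eps / 100) * lam1 by ring.
have -> : eps / 100 * lam1 / ((b + eps / 100) * lam1) = eps / (100 * b + eps).
  by field; rewrite !gt_eqF //; lra.
set t := Num.sqrt (eps / _).
have k0 : 0 < 100 * b + eps by lra.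
have it : t^-1 <= 11 * Num.sqrt (b / eps).
  rewrite /t -sqrtrV; last by rewrite divr_ge0 // ltW.
  have -> : 11 * Num.sqrt (b / eps) = Num.sqrt (11 ^+ 2 * (b / eps)).
    by rewrite [RHS]sqrtrM ?sqr_ge0 // sqrtr_sqr ger0_norm.
  rewrite ler_wsqrtr // invfM invrK mulrC mulrA ler_pM2r ?invr_gt0 //; lra.
have S1 : 1 <= Num.sqrt (b / eps).
  by rewrite -[leLHS]sqrtr1 ler_wsqrtr // ler_pdivlMr ?mul1r.
have t0 : 0 <= t^-1 by rewrite invr_ge0 sqrtr_ge0.
have L0 : 0 <= 248 * L by lra.
apply: le_trans (nat_above_le _) _; first by rewrite mulr_ge0.
have := ler_wpM2l L0 it.
move: (Num.sqrt (b / eps)) t^-1 S1 => S i S1 H.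
have LS : 1 <= L * S by rewrite mulr_ege1.
by lra.
Qed.

Lemma schedule_power_iters : (power_iters P)%:R <= 12 * L.
Proof.
have L1 := log_scale_ge1 d_gt0 eps01.
by apply: le_trans (nat_above_le _) _; lra.
Qed.

Lemma schedule_epochs_le : (epochs P)%:R <= 21 * L.
Proof.
have L1 := log_scale_ge1 d_gt0 eps01.
by apply: le_trans (nat_above_le _) _; lra.
Qed.

Lemma sqrt_ratio_powR :
  nz%:R * Num.sqrt (beta / eps) =
  nz%:R `^ (3 / 4) * (d%:R * sr) `^ (1 / 4) / Num.sqrt eps.
Proof.
have /andP[e0 e1] := eps01.
have sr0 : 0 <= sr by exact: le_trans sr1.
have q0 : 0 <= sr * d%:R / nz%:R by rewrite divr_ge0 ?(ltW nzR) // mulr_ge0 // ltW.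
rewrite reg_ratioE sqrtrM ?sqrtr_ge0 // sqrtrV ?(ltW e0) // mulrA; congr (_ / _).
rewrite -!powR12_sqrt ?powR_ge0 // -powRrM.
have -> : d%:R * sr = sr * d%:R / nz%:R * nz%:R by field; rewrite !gt_eqF.
move: (sr * d%:R / nz%:R) q0 => q q0.
rewrite powRM ?(ltW nzR) // [q `^ (1 / 4) * _]mulrC mulrA -powRD.
  have -> : 3 / 4 + 1 / 4 = 1 :> R by field.
  have -> : 2^-1 * 2^-1 = 1 / 4 :> R by field.
  by rewrite powRr1 ?(ltW nzR).
by rewrite gt_eqF // implybT.
Qed.

(** Here [d >= 2] enters: it gives [ln (d / eps) >= 1/2], which absorbs the summand 1. *)
Lemma log_scale_le : L <= 3 * ln (d%:R / eps).
Proof.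
have /andP[e0 e1] := eps01.
have H : 2 <= d%:R / eps.
  have d2 : 2 <= d%:R :> R by rewrite ler_nat; case/andP: dn.
  rewrite ler_pdivlMr //; lra.
have : 2^-1 <= ln (d%:R / eps).
  rewrite -[leLHS]expRK ler_ln ?posrE ?expR_gt0 ?divr_gt0 //.
  exact: le_trans (expR_half_le2 R) H.
by rewrite /log_scale; lra.
Qed.

Lemma schedule_time : (power_time d nz P)%:R <=
  20 ^+ 11 * (nz%:R `^ (3 / 4) * (d%:R * sr) `^ (1 / 4) / Num.sqrt eps
              * ln (d%:R / eps) ^+ 3).
Proof.
have /andP[e0 e1] := eps01.
have be : eps <= beta by rewrite le_max lexx.
have L1 := log_scale_ge1 d_gt0 eps01.
have S1 : 1 <= Num.sqrt (beta / eps).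
  by rewrite -[leLHS]sqrtr1 ler_wsqrtr // ler_pdivlMr ?mul1r.
have dn0 : (0 < d <= nz)%N by rewrite d_gt0; case/andP: dn.
apply: le_trans (power_time_le dn0 L1 S1 schedule_power_iters
  schedule_accel_iters schedule_epochs_le schedule_epoch_length) _.
rewrite -sqrt_ratio_powR.
have Ll : L ^+ 3 <= 3 ^+ 3 * ln (d%:R / eps) ^+ 3.
  rewrite -exprMn lerXn2r ?nnegrE ?log_scale_le //; first lra.
  by have := log_scale_le; lra.
have nS : 0 <= nz%:R * Num.sqrt (beta / eps) by rewrite mulr_ge0 ?sqrtr_ge0.
have H := ler_wpM2l nS Ll.
have P0 : 0 <= nz%:R * Num.sqrt (beta / eps) * L ^+ 3.
  by rewrite mulr_ge0 // exprn_ge0 //; lra.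
move: (nz%:R * Num.sqrt (beta / eps)) (L ^+ 3) (ln _ ^+ 3) H P0 => a b c H P0.
lra.
Qed.

End TimeBound.

Theorem theorem8p4 (R : realType) :
  exists (C : R) (schedule : nat -> nat -> R -> R -> R -> params R),
    0 < C /\
    forall (n d : nat) (A : 'M[R]_(n, d)) (lambda1 eps : R),
      A != 0 ->
      largest_eigenvalue (A^T *m A) lambda1 ->
      0 < eps < 1 ->
      let Sigma := A^T *m A in
      let lambda := (1 + eps / 100) * lambda1 in
      let algorithm := shift_invert_power A lambda
            (schedule (nnz A) d (frobenius2 A) lambda eps) in
      exists time : nat,
        [/\ runs algorithm time (fun x => enorm x = 1),
            ((1 - C / d%:R ^+ 10)%:E <=
              prob algorithm
                (fun x => (1 - eps) * lambda1 <= (x^T *m Sigma *m x) 0 0)%R)%E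
          & (1 < d <= nnz A)%N ->
            (nnz A)%:R <= d%:R * stable_rank A / eps ^+ 2 ->
            time%:R <= C * ((nnz A)%:R `^ (3 / 4)
                             * (d%:R * stable_rank A) `^ (1 / 4) / Num.sqrt eps
                             * ln (d%:R / eps) ^+ 3)].
Proof.
(* The constant is dictated by the failure probability. The schedule is given the shift and recovers
   the top eigenvalue from it. *)
exists (20 ^+ 11), (fun nz d F lam eps =>
  schedule_at nz d F (lam / (1 + eps / 100)) lam eps).
split=> [|n d A lambda1 eps A0 [ev_lambda1 max_lambda1] eps01 Sigma lambda].
  by rewrite exprn_gt0.
have /andP[e0 e1] := eps01.
have -> : lambda / (1 + eps / 100) = lambda1.
  by rewrite /lambda mulrC mulKf // gt_eqF // addr_gt0 // divr_gt0.
have top : forall x, form (A^T *m A) x x <= lambda1 * dot x x.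
  exact: rayleigh_le (gram_sym A) max_lambda1.
have [u u1 Au] : exists2 u : 'cV[R]_d, dot u u = 1 & A^T *m A *m u = lambda1 *: u.
  have [v vA v0] := eigenvalueP ev_lambda1.
  have w0 : v^T != 0 by rewrite trmx_eq0.
  (* [eigenvalue] provides a left eigenvector; by symmetry of the Gram matrix its transpose is a
     right one. *)
  exists ((Num.sqrt (dot v^T v^T))^-1 *: v^T).
    by rewrite -enorm_sqr enorm_sqrt_dot_inv // expr1n.
  rewrite -scalemxAr -{1}(gram_sym A) -trmx_mul vA linearZ /=.
  by rewrite !scalerA mulrC.
have d0 := dim_gt0 u1.
exists (power_time d (nnz A) (schedule_at (nnz A) d (frobenius2 A) lambda1
  lambda eps)).
split; first exact: runs_shift_invert_power.
  exact: shift_invert_power_success u1 Au eps01.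
have l0 := rayleigh_top_gt0 A0 top.
rewrite (stable_rankE top u1 Au) => dn nz_le.
apply: schedule_time => //.
by rewrite ler_pdivlMr // mul1r (top_le_frobenius2 u1 Au).
Qed.
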